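(* Let $A=(a_{i,j})_{i,j\in\mathbb{Z}}$ be the matrix with $a_{i,j}=1$ if $i\geq j$ and $a_{i,j}=0$ otherwise. Let $O_A$ be the associated Exel-Laca $C^*$-algebra with generating partial isometries $s_i$, $i\in\mathbb{Z}$, and let $\mathcal{W}$ be the concrete weakly monotone $C^*$-algebra generated by the weakly monotone annihilators $A_i$, $i\in\mathbb{Z}$. Then the assignment $s_i\mapsto A_i^\dagger$, $i\in\mathbb{Z}$, extends to a faithful ($*$-)representation of $O_A$ on the weakly monotone Fock space, with values in $\mathcal{W}$. In particular, $\mathcal{W}\cong O_A$.
   Context: Weakly monotone Fock space: let $\mathcal{H}=\ell^2(\mathbb{Z})$ with canonical orthonormal basis $\{e_k:k\in\mathbb{Z}\}$. $\mathcal{F}_{wm}(\mathcal{H})$ is the closed subspace of the full Fock space over $\mathcal{H}$ with orthonormal basis consisting of the vacuum vector $\Omega$ (the tensor of length $0$) and all simple tensors $e_{i_1}\otimes\cdots\otimes e_{i_k}$ with $k\geq 1$, $i_1\geq i_2\geq\cdots\geq i_k$, $i_j\in\mathbb{Z}$. For $i\in\mathbb{Z}$ the creator $A_i^\dagger$ is the bounded operator with $A_i^\dagger\Omega=e_i$ and $A_i^\dagger\, e_{i_1}\otimes\cdots\otimes e_{i_k}=e_i\otimes e_{i_1}\otimes\cdots\otimes e_{i_k}$ if $i\geq i_1$, and $=0$ otherwise; the annihilator $A_i$ is its adjoint. $\mathcal{W}\subset\mathcal{B}(\mathcal{F}_{wm}(\mathcal{H}))$ is the (not assumed unital) $C^*$-algebra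 generated by $\{A_i:i\in\mathbb{Z}\}$. Exel-Laca algebra: for finite subsets $X,Y\subset\mathbb{Z}$ and $j\in\mathbb{Z}$ put $a(X,Y,j)=\prod_{x\in X}a_{x,j}\prod_{y\in Y}(1-a_{y,j})$ (empty products equal $1$). $O_A$ is the universal $C^*$-algebra generated by partial isometries $\{s_i:i\in\mathbb{Z}\}$, with $q_i=s_i^*s_i$, $p_i=s_is_i^*$, subject to: (1) $q_iq_j=q_jq_i$ for all $i,j$; (2) $p_ip_j=0$ for $i\neq j$; (3) $q_ip_j=a_{i,j}p_j$ for all $i,j$; (4) $\prod_{x\in X}q_x\prod_{y\in Y}(1-q_y)=\sum_{j\in\mathbb{Z}}a(X,Y,j)p_j$ for all finite $X,Y\subset\mathbb{Z}$ such that $a(X,Y,j)\neq 0$ for only finitely many $j$ (the products being computed in the unitization). *)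

(* Defs.v *)
From HB Require Import structures.
From mathcomp Require Import all_boot all_order all_algebra finmap.
From mathcomp Require Import all_classical all_reals.
From mathcomp Require Import ereal topology normedtype esum complex ring.

Set Implicit Arguments.
Unset Strict Implicit.
Unset Printing Implicit Defensive.

Import Order.TTheory GRing.Theory Num.Theory.
Import numFieldNormedType.Exports.

Local Open Scope classical_set_scope.
Local Open Scope ring_scope.
Local Open Scope complex_scope.

(* In a normed module over R[i] the norm is R[i]-valued (with nonnegative real
   values), which is why the norm axioms below are stated in R[i].
   C*-algebras are not assumed unital. *)
HB.mixin Record CompleteNormedModule_isCStarAlg (R : realType) B
    of CompleteNormedModule R[i] B := {
  cmul : B -> B -> B ;
  cstar : B -> B ;
  cmulA : associative cmul ;
  cmulDl : left_distributive cmul +%R ;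
  cmulDr : right_distributive cmul +%R ;
  cmulZl : forall (a : R[i]) (x y : B), cmul (a *: x) y = a *: cmul x y ;
  cmulZr : forall (a : R[i]) (x y : B), cmul x (a *: y) = a *: cmul x y ;
  cstarD : {morph cstar : x y / x + y} ;
  cstarZ : forall (a : R[i]) (x : B), cstar (a *: x) = conjc a *: cstar x ;
  cstarM : forall x y : B, cstar (cmul x y) = cmul (cstar y) (cstar x) ;
  cstarK : involutive cstar ;
  ler_norm_cmul : forall x y : B, `|cmul x y| <= `|x| * `|y| ;
  norm_cmul_cstar : forall x : B, `|cmul (cstar x) x| = `|x| ^+ 2
}.

#[short(type="cstarAlgType")]
HB.structure Definition CStarAlg (R : realType) :=
  {B of CompleteNormedModule R[i] B & CompleteNormedModule_isCStarAlg R B}.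

Infix "**" := cmul (at level 40, left associativity) : ring_scope.

Section CStarAlgTheory.
Context {R : realType}.

Definition cstar_subalg (B : cstarAlgType R) (D : set B) : Prop :=
  [/\ D 0,
      forall (a : R[i]) x y, D x -> D y -> D (a *: x + y),
      forall x y, D x -> D y -> D (x ** y),
      forall x, D x -> D (cstar x) &
      closed D].

Definition cstar_gen (B : cstarAlgType R) (S : set B) : set B :=
  \bigcap_(D in [set D | cstar_subalg D /\ S `<=` D]) D.

Definition star_hom (B D : cstarAlgType R) (phi : B -> D) : Prop :=
  [/\ forall (a : R[i]) x y, phi (a *: x + y) = a *: phi x + phi y,
      forall x y, phi (x ** y) = phi x ** phi y &
      forall x, phi (cstar x) = cstar (phi x)].

End CStarAlgTheory.

Section ExelLaca.
Context {R : realType} (A : int -> int -> bool).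

Definition el_coef (X Y : {fset int}) (j : int) : R[i] :=
  (\prod_(x <- X) (A x j)%:R) * \prod_(y <- Y) (1 - (A y j)%:R).

Section Relations.
Context {B : cstarAlgType R} (s : int -> B).

Definition el_q (i : int) : B := cstar (s i) ** s i.
Definition el_p (i : int) : B := s i ** cstar (s i).

(* The element \prod_(x in X) q_x \prod_(y in Y) (1 - q_y) of the unitization
   of B, the latter realized as the algebra of the operators
   b |-> c ** b + z *: b on B.  This is B itself when B has a unit, and B with
   a unit adjoined otherwise. *)
Definition el_prod (X Y : {fset int}) : B -> B :=
  (\big[(fun f g => f \o g)/id]_(x <- X) (fun b => el_q x ** b)) \o
  (\big[(fun f g => f \o g)/id]_(y <- Y) (fun b => b - el_q y ** b)).

Record exel_laca_family : Prop := {
  el_partial_isometry : forall i, s i ** cstar (s i) ** s i = s i ;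
  el_qC : forall i j, el_q i ** el_q j = el_q j ** el_q i ;
  el_p_orth : forall i j, i != j -> el_p i ** el_p j = 0 ;
  el_qp : forall i j, el_q i ** el_p j = (A i j)%:R *: el_p j ;
  el_prodE : forall X Y : {fset int},
    finite_set [set j | el_coef X Y j != 0] ->
    el_prod X Y =
      fun b => (\sum_(j \in [set: int]) el_coef X Y j *: el_p j) ** b
}.

End Relations.

(* (O, s) is the universal C*-algebra of the Exel-Laca relations of A, which
   determines it up to a unique isomorphism. *)
Record is_exel_laca (O : cstarAlgType R) (s : int -> O) : Prop := {
  exel_laca_rel : exel_laca_family s ;
  exel_laca_gen : cstar_gen (range s) = setT ;
  exel_laca_univ : forall (B : cstarAlgType R) (t : int -> B),
    exel_laca_family t ->
    exists phi : O -> B, star_hom phi /\ forall i, phi (s i) = t i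
}.

End ExelLaca.

Section Ell2.
Context {R : realType} {I : choiceType}.

Definition sqr_mass (f : I -> R[i]) : \bar R :=
  (\esum_(i in [set: I]) (Normc.normc (f i) ^+ 2)%:E)%E.

Definition ell2_pred : {pred I -> R[i]} :=
  fun f => `[< (sqr_mass f < +oo)%E >].

Lemma sqr_massP (f : I -> R[i]) : reflect (sqr_mass f < +oo)%E (f \in ell2_pred).
Proof. exact: asboolP. Qed.

Lemma normc_sqr (x : R[i]) :
  Normc.normc x ^+ 2 = complex.Re x ^+ 2 + complex.Im x ^+ 2.
Proof. by case: x => a b /=; rewrite sqr_sqrtr// addr_ge0// sqr_ge0. Qed.

Lemma sqr_mass_scale (f : I -> R[i]) (c : R) : 0 <= c ->
  (sqr_mass f < +oo)%E ->
  (\esum_(i in [set: I]) (c * Normc.normc (f i) ^+ 2)%:E < +oo)%E.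
Proof.
move=> c0 ff; apply: (@le_lt_trans _ _ (c%:E * sqr_mass f)%E); last first.
  by rewrite lte_mul_pinfty// lee_fin.
apply: ge_ereal_sup => _ /= [F [Ffin _] <-].
under eq_fsbigr do rewrite EFinM.
rewrite -ge0_mule_fsumr; last by move=> i; rewrite lee_fin sqr_ge0.
rewrite lee_wpmul2l ?lee_fin//.
by apply: ereal_sup_ubound; exists F => //; split.
Qed.

Fact ell2_submod : submod_closed ell2_pred.
Proof.
split=> [|a f g /sqr_massP ff /sqr_massP gf]; apply/sqr_massP.
  rewrite /sqr_mass esum1 ?ltry// => i _.
  by rewrite (_ : (0 : I -> R[i]) i = 0)// Normc.normc0 expr0n.
pose M := 2 * Normc.normc a ^+ 2.
have M0 : 0 <= M by rewrite mulr_ge0// sqr_ge0.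
have nn (h : I -> R[i]) (c : R) : 0 <= c ->
    forall i, [set: I] i -> (0 <= (c * Normc.normc (h i) ^+ 2)%:E)%E.
  by move=> c0 i _; rewrite lee_fin mulr_ge0// sqr_ge0.
apply: (@le_lt_trans _ _ (\esum_(i in [set: I])
    ((M * Normc.normc (f i) ^+ 2)%:E + (2 * Normc.normc (g i) ^+ 2)%:E))%E).
  apply: le_esum => i _; rewrite -EFinD lee_fin /M -mulrA -exprMn.
  rewrite -Normc.normcM (_ : (a *: f + g) i = a * f i + g i)//.
  case: (a * f i) (g i) => [u1 u2] [v1 v2]; rewrite !normc_sqr /=.
  rewrite -subr_ge0 [X in 0 <= X](_ : _ = (u1 - v1) ^+ 2 + (u2 - v2) ^+ 2).
    by rewrite addr_ge0// sqr_ge0.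
  by ring.
by rewrite esumD; [rewrite lte_add_pinfty// sqr_mass_scale|exact: nn..].
Qed.

HB.instance Definition _ :=
  GRing.isSubmodClosed.Build R[i] (I -> R[i]) ell2_pred ell2_submod.

(* The Hilbert space ell^2(I). *)
Record ell2 := Ell2 { ell2_fun :> I -> R[i] ; _ : ell2_fun \in ell2_pred }.

HB.instance Definition _ := [isSub for ell2_fun].
HB.instance Definition _ := [Choice of ell2 by <:].
HB.instance Definition _ := [SubChoice_isSubLmodule of ell2 by <:].

Definition l2norm (f : ell2) : R := Num.sqrt (fine (sqr_mass f)).

(* Unconditional convergence of the family u to l. *)
Definition has_sum (u : I -> R[i]) (l : R[i]) : Prop :=
  forall e : R, 0 < e -> exists F : {fset I}, forall G : {fset I},
    (F `<=` G)%fset -> Normc.normc (\sum_(i <- G) u i - l) < e.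

(* linear in the first argument *)
Definition l2dot (f g : ell2) : R[i] :=
  xget 0 [set l | has_sum (fun i => f i * conjc (g i)) l].

Fact ell2_basis_subproof (i : I) :
  (fun j => (j == i)%:R : R[i]) \in ell2_pred.
Proof.
apply/sqr_massP; rewrite /sqr_mass (esumID [set i])//; last first.
  by move=> j _; rewrite lee_fin sqr_ge0.
rewrite setTI esum_set1 ?lee_fin ?sqr_ge0// eqxx.
rewrite esum1 ?adde0 ?ltry// => j [_ /eqP/negPf ->].
by rewrite Normc.normc0 expr0n.
Qed.

Definition ell2_basis (i : I) : ell2 := Ell2 (ell2_basis_subproof i).

Definition bounded_op (T : ell2 -> ell2) : Prop :=
  (forall (a : R[i]) f g, T (a *: f + g) = a *: T f + T g) /\
  exists M : R, forall f, l2norm (T f) <= M * l2norm f.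

(* The Hilbert space adjoint; it exists and is unique when T is bounded. *)
Definition adjoint (T : ell2 -> ell2) : ell2 -> ell2 :=
  xget (fun=> 0) [set S | forall f g, l2dot (T f) g = l2dot f (S g)].

(* Norm-closed *-subalgebras of B(ell^2(I)); the last clause is closedness for
   the operator norm. *)
Record op_star_subalg (D : set (ell2 -> ell2)) : Prop := {
  op_bounded : forall T, D T -> bounded_op T ;
  op_zero : D (fun=> 0) ;
  op_lin : forall (a : R[i]) T S, D T -> D S -> D (fun f => a *: T f + S f) ;
  op_comp : forall T S, D T -> D S -> D (T \o S) ;
  op_adjoint : forall T, D T -> D (adjoint T) ;
  op_closed : forall T, bounded_op T ->
    (forall e : R, 0 < e ->
      exists2 S, D S & forall f, l2norm (T f - S f) <= e * l2norm f) -> D T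
}.

Definition op_cstar_gen (G : set (ell2 -> ell2)) : set (ell2 -> ell2) :=
  \bigcap_(D in [set D | op_star_subalg D /\ G `<=` D]) D.

Definition star_rep (B : cstarAlgType R) (pi : B -> ell2 -> ell2) : Prop :=
  [/\ forall x, bounded_op (pi x),
      forall (a : R[i]) x y, pi (a *: x + y) = (fun f => a *: pi x f + pi y f),
      forall x y, pi (x ** y) = pi x \o pi y &
      forall x, pi (cstar x) = adjoint (pi x)].

End Ell2.

Arguments ell2 R I : clear implicits.

(* The words of weakly decreasing integers; [::] is the vacuum. *)
Definition wm_word : Type := {w : seq int | sorted (fun i j => j <= i) w}.

HB.instance Definition _ := Choice.on wm_word.

Section WeaklyMonotone.
Context {R : realType}.

(* The full Fock space over ell^2(Z) is ell^2(seq int), the simple tensor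
   e_{i_1} (x) ... (x) e_{i_k} being the basis vector of the word
   [:: i_1; ...; i_k].  Its closed subspace spanned by the weakly decreasing
   words is ell^2(wm_word). *)
Definition wm_fock := ell2 R wm_word.

(* The word w with v = i :: w, if any. *)
Definition wm_uncons (i : int) (v : wm_word) : option wm_word :=
  if val v is j :: w then if j == i then insub w else None else None.

Lemma wm_uncons_val i v w :
  wm_uncons i v = Some w <-> val v = i :: val w.
Proof.
rewrite /wm_uncons; case: v => -[|j u] /= sv; first by split.
split=> [|[-> uw]]; first by case: eqP => // -> ; case: insubP => // x _ <- [->].
by rewrite eqxx uw valK.
Qed.

Fact wm_creator_subproof (i : int) (f : wm_fock) :
  (fun v => if wm_uncons i v is Some w then f w else 0) \in ell2_pred.
Proof.
set g := fun v => _.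
have g0 v : [set: wm_word] v -> (0 <= (Normc.normc (g v) ^+ 2)%:E)%E.
  by rewrite lee_fin sqr_ge0.
have f0 v : [set: wm_word] v -> (0 <= (Normc.normc (f v) ^+ 2)%:E)%E.
  by rewrite lee_fin sqr_ge0.
have /sqr_massP : ell2_fun f \in ell2_pred by case: (f).
pose c (w : wm_word) : wm_word := odflt w (insub (i :: val w)).
pose E := [set w | wm_uncons i (c w) = Some w].
have cinj : set_inj E c.
  by move=> w w' /set_mem Ew /set_mem Ew' cw; apply: Some_inj; rewrite -Ew cw.
move=> ffin; apply/sqr_massP; apply: le_lt_trans ffin.
rewrite /sqr_mass (esumID (c @` E))// setTI [X in (_ + X)%E]esum1 => [|v].
  rewrite adde0 esum_image// [leRHS](esumID E)// setTI.
  rewrite (_ : (\esum_(w in E) (Normc.normc (g (c w)) ^+ 2)%:E)%E =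
    (\esum_(w in E) (Normc.normc (f w) ^+ 2)%:E)%E).
    by rewrite leeDl// esum_ge0// => w _; exact: f0.
  by apply: eq_esum => w; rewrite /E /= /g => ->.
move=> [_ nv]; rewrite /g; case vw: (wm_uncons i v) => [w|]; last first.
  by rewrite Normc.normc0 expr0n.
exfalso; apply: nv; exists w.
  rewrite /E /= /c -(_ : val v = i :: val w) ?valK//.
  exact/wm_uncons_val.
by rewrite /c -(_ : val v = i :: val w) ?valK//; exact/wm_uncons_val.
Qed.

Definition wm_creator (i : int) (f : wm_fock) : wm_fock :=
  Ell2 (wm_creator_subproof i f).

Lemma wm_creator_basis (i : int) (w : wm_word) :
  wm_creator i (ell2_basis w) =
  if insub (i :: val w) is Some v then ell2_basis (v : wm_word) else 0.
Proof.
apply/val_inj/funext => v /=.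
case: insubP => [u _ uE|niw] /=.
  case vw: (wm_uncons i v) => [w'|].
    have /wm_uncons_val vE := vw; congr ((_ : bool)%:R).
    by rewrite -!val_eqE /= vE uE eqseq_cons eqxx.
  case: eqP => // vu; have /wm_uncons_val : val v = i :: val w by rewrite vu.
  by rewrite vw.
case vw: (wm_uncons i v) => [w'|//].
case: eqP => // w'w; move/wm_uncons_val: vw niw; rewrite w'w => <-.
by rewrite (valP v).
Qed.

Definition wm_annihilator (i : int) : wm_fock -> wm_fock :=
  adjoint (wm_creator i).

Definition wm_algebra : set (wm_fock -> wm_fock) :=
  op_cstar_gen (range wm_annihilator).

End WeaklyMonotone.

Arguments wm_fock R : clear implicits.
Arguments wm_algebra R : clear implicits.

Definition wm_matrix (i j : int) : bool := j <= i.

(* Main.v *)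
Require Import Defs.
From HB Require Import structures.
From mathcomp Require Import all_boot all_order all_algebra finmap zify ring lra.
From mathcomp Require Import all_classical all_reals.
From mathcomp Require Import ereal topology normedtype esum complex.

Set Implicit Arguments.
Unset Strict Implicit.
Unset Printing Implicit Defensive.

Import Order.TTheory GRing.Theory Num.Theory.
Import numFieldNormedType.Exports.

Local Open Scope classical_set_scope.
Local Open Scope ring_scope.
Local Open Scope complex_scope.

(** For the matrix [i >= j] the Exel-Laca relations say that, with
    q_i = s_i^* s_i and p_i = s_i s_i^*, the projections q_i increase with i,
    q_i - q_(i-1) = p_i, the product q_i s_j is s_j when j <= i and 0 otherwise,
    and s_i^* s_j = 0 when i and j differ.  With these rules every monomial in
    the s_i and their adjoints is 0 or s_u q_k s_v^* for two weakly decreasing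
    words u and v; which of them it is depends on the monomial alone ([monoE]).

    The heart of the proof is the inequality [cnorm_peval_le]: if t and s are
    two families satisfying the relations, in any two C*-algebras, and all the
    q_i of s are nonzero, then |y(t)| <= |y(s)| for every *-polynomial y.  Let y
    have degree less than N and letters in the window b < i <= b + k.  Iterating
    q_i = p_i + q_(i-1) = s_i q_i s_i^* + q_(i-1) splits q_(b+k) into N layers
    ([el_q_partition]), which turns y(t) into a sum of c_uv(y) theta_uv(t) over
    the pairs of words (u, v) of the window of length at most N, where the
    theta_uv(t) are contractions and the scalars c_uv(y) do not depend on the
    family ([peval_expand]).  Conversely, compressing y(s) recovers the scalars:
    q_b s_u^* y(s) s_v q_b = c_uv(y) q_b ([compress_peval]), so
    |c_uv(y)| <= |y(s)| because q_b is a nonzero projection.  There are at most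
    (N + 1)^(2k) pairs (u, v), so |y(t)| <= C(deg y) |y(s)| with C a polynomial.
    By the C*-identity, replacing y by z = y^* y squared n times raises both
    norms to the power 2^(n+1) and multiplies the degree by 2^(n+1) only; hence
    the constant C disappears ([tensor_power_trick]).

    It follows that a C*-algebra generated by a family whose q_i are all nonzero
    is universal, the *-homomorphism to another family being isometric when the
    q_i of that family are nonzero too ([star_hom_exists]).

    The weakly monotone algebra W is such a C*-algebra: norm-closed
    *-subalgebras of B(ell^2) are C*-algebras, the creators satisfy the
    relations ([wm_gen_family]), and every q_i fixes the vacuum.  So W is itself
    an Exel-Laca algebra.  If O is any other one, its q_i are nonzero since its
    universal property maps them to those of W; hence s_i |-> A_i^dagger extends
    to an isometric *-homomorphism from O to W, and the one from W to O is its
    inverse. *)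

(** * Norms in C*-algebras *)
Section CStarNorm.
Context {R : realType} {B : cstarAlgType R}.
Implicit Types (x y z : B) (a : R[i]).

(** The norm as a real number, for comparisons in the totally ordered R. *)
Definition cnorm x : R := complex.Re `|x|.

Lemma cnormE x : `|x| = (cnorm x)%:C.
Proof. by rewrite /cnorm RRe_real// realE normr_ge0. Qed.

Lemma cnorm_ge0 x : 0 <= cnorm x.
Proof. by rewrite -ler0c -cnormE. Qed.

Lemma cnorm0 : cnorm 0 = 0.
Proof. by apply: complexI; rewrite -cnormE normr0. Qed.

Lemma cnorm_eq0 x : cnorm x = 0 -> x = 0.
Proof. by move=> x0; apply/eqP; rewrite -normr_eq0 cnormE x0. Qed.

Lemma cnormD x y : cnorm (x + y) <= cnorm x + cnorm y.
Proof. by rewrite -lecR raddfD/= -!cnormE ler_normD. Qed.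

Lemma cnormN x : cnorm (- x) = cnorm x.
Proof. by rewrite /cnorm normrN. Qed.

Lemma cnormB x y : cnorm (x - y) = cnorm (y - x).
Proof. by rewrite -cnormN opprB. Qed.

Lemma cnormZ a x : cnorm (a *: x) = Normc.normc a * cnorm x.
Proof. by apply: complexI; rewrite rmorphM/= -!cnormE normrZ. Qed.

Lemma cnormM x y : cnorm (x ** y) <= cnorm x * cnorm y.
Proof. by rewrite -lecR rmorphM/= -!cnormE ler_norm_cmul. Qed.

Lemma cnorm_sqr x : cnorm (cstar x ** x) = cnorm x ^+ 2.
Proof. by apply: complexI; rewrite rmorphXn/= -!cnormE norm_cmul_cstar. Qed.

Lemma cnorm_star x : cnorm (cstar x) = cnorm x.
Proof.
suff le_star y : cnorm y <= cnorm (cstar y).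
  by apply/eqP; rewrite eq_le le_star andbT -{2}[x]cstarK le_star.
have [->|y0] := eqVneq (cnorm y) 0; first exact: cnorm_ge0.
have yp : 0 < cnorm y by rewrite lt_neqAle eq_sym y0 cnorm_ge0.
by rewrite -(ler_pM2r yp) -expr2 -cnorm_sqr cnormM.
Qed.

Lemma cnorm_sum (J : Type) (r : seq J) (P : pred J) (F : J -> B) :
  cnorm (\sum_(j <- r | P j) F j) <= \sum_(j <- r | P j) cnorm (F j).
Proof.
elim/big_ind2 : _ => [|x u y v xu yv|//]; first by rewrite cnorm0.
by rewrite (le_trans (cnormD _ _))// lerD.
Qed.

(** The hypothesis says that [x] is a projection: it is selfadjoint, being of the
    form x^* x, and then idempotent. *)
Lemma cnorm_proj_le1 x : cstar x ** x = x -> cnorm x <= 1.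
Proof.
move=> xx; have := cnorm_sqr x; rewrite xx => e.
have := cnorm_ge0 x; have [//|x1] := leP (cnorm x) 1.
nra.
Qed.

Lemma cnorm_proj x : cstar x ** x = x -> x != 0 -> cnorm x = 1.
Proof.
move=> xx x0; have := cnorm_sqr x; rewrite xx => e.
have nx0 : cnorm x != 0 by apply: contra_neq x0 => /cnorm_eq0.
by apply: (mulfI nx0); rewrite -expr2 -e mulr1.
Qed.

End CStarNorm.

Section CStarRing.
Context {R : realType} {B : cstarAlgType R}.
Implicit Types (x y z : B) (a : R[i]).

Lemma cmul0r x : 0 ** x = 0.
Proof. by have := cmulZl 0 0 x; rewrite !scale0r. Qed.

Lemma cmulr0 x : x ** 0 = 0.
Proof. by have := cmulZr 0 x 0; rewrite !scale0r. Qed.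

Lemma cmulNr x y : (- x) ** y = - (x ** y).
Proof. by rewrite -scaleN1r cmulZl scaleN1r. Qed.

Lemma cmulrN x y : x ** (- y) = - (x ** y).
Proof. by rewrite -scaleN1r cmulZr scaleN1r. Qed.

Lemma cstar0 : cstar 0 = 0 :> B.
Proof. by have := cstarZ 0 (0 : B); rewrite conjc0 !scale0r. Qed.

Lemma cstarN x : cstar (- x) = - cstar x.
Proof. by rewrite -scaleN1r cstarZ rmorphN1 scaleN1r. Qed.

Lemma cmul_suml (J : Type) (r : seq J) (P : pred J) (F : J -> B) y :
  (\sum_(j <- r | P j) F j) ** y = \sum_(j <- r | P j) F j ** y.
Proof.
by apply: (big_morph (fun x => x ** y)) => [u v|]; rewrite ?cmulDl ?cmul0r.
Qed.

Lemma cmul_sumr (J : Type) (r : seq J) (P : pred J) (F : J -> B) y :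
  y ** (\sum_(j <- r | P j) F j) = \sum_(j <- r | P j) y ** F j.
Proof. by apply: (big_morph (cmul y)) => [u v|]; rewrite ?cmulDr ?cmulr0. Qed.

Lemma cstar_sum (J : Type) (r : seq J) (P : pred J) (F : J -> B) :
  cstar (\sum_(j <- r | P j) F j) = \sum_(j <- r | P j) cstar (F j).
Proof. exact: (big_morph _ cstarD cstar0). Qed.

End CStarRing.

(** * The relations for the matrix [i >= j] *)
Lemma enum_fset_fset1 (K : choiceType) (x : K) : enum_fset [fset x]%fset = [:: x].
Proof.
apply: perm_small_eq => //; apply: uniq_perm => // y.
by rewrite -[LHS]/(y \in [fset x]%fset) in_fset1 inE.
Qed.

Section Family.
Context {R : realType} {B : cstarAlgType R} (t : int -> B).
Implicit Types (i j k b : int) (x y z : B) (u v w : seq int).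

Local Notation q := (el_q t).

Lemma star_el_q i : cstar (q i) = q i.
Proof. by rewrite /el_q cstarM cstarK. Qed.

Lemma star_el_p i : cstar (el_p t i) = el_p t i.
Proof. by rewrite /el_p cstarM cstarK. Qed.

Lemma el_coef1 i j k :
  el_coef wm_matrix [fset i]%fset [fset j]%fset k = (j < k <= i)%R%:R :> R[i].
Proof.
rewrite /el_coef !enum_fset_fset1 !big_cons !big_nil !mulr1 /wm_matrix.
by case: (leP k j); rewrite ?subrr ?mulr0 ?subr0 ?mulr1.
Qed.

Hypothesis tP : exel_laca_family wm_matrix t.

(** The relation on products for X = {i} and Y = {j}, whose coefficients have
    finite support j < k <= i; this one case yields the order of the q_i. *)
Lemma el_prod1 i j x : 
  q i ** (x - q j ** x) =
  (\sum_(k \in [set: int]) (j < k <= i)%R%:R *: el_p t k) ** x.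
Proof.
have fin : finite_set [set k | el_coef wm_matrix [fset i]%fset [fset j]%fset k
    != (0 : R[i])].
  have := finite_fset [fset (j + n%:Z)%R | n in iota 0 (`|i - j|.+1)%N]%fset.
  apply: sub_finite_set => k; rewrite /= el_coef1.
  case jki: (j < k <= i); last by rewrite eqxx.
  move=> _; apply/imfsetP; exists (`|k - j|)%N; last by lia.
  by rewrite inE /= mem_iota; lia.
have /(congr1 (fun f => f x)) := el_prodE tP fin.
rewrite /el_prod !enum_fset_fset1 !big_cons !big_nil /=.
by under eq_fsbigr do rewrite el_coef1.
Qed.

Lemma el_p_mul i : el_p t i ** t i = t i.
Proof. exact: el_partial_isometry tP i. Qed.

Lemma star_mul_el_p i : cstar (t i) ** el_p t i = cstar (t i).
Proof. by rewrite -[RHS](congr1 cstar (el_p_mul i)) cstarM star_el_p. Qed.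

Lemma el_q_idem i : q i ** q i = q i.
Proof.
by rewrite /el_q -[LHS]cmulA [t i ** _]cmulA -/(el_p t i) el_p_mul.
Qed.

Lemma el_q_mul i j : q i ** t j = if j <= i then t j else 0.
Proof.
rewrite -[in LHS](el_p_mul j) cmulA (el_qp tP) /wm_matrix.
by case: ifP => _; rewrite ?scale1r ?scale0r ?cmul0r ?el_p_mul.
Qed.

Lemma star_mul_el_q i j : cstar (t j) ** q i = if j <= i then cstar (t j) else 0.
Proof.
rewrite -(star_el_q i) -cstarM el_q_mul.
by case: ifP => _ //; rewrite cstar0.
Qed.

Lemma mul_el_q i : t i ** q i = t i.
Proof. by rewrite /el_q cmulA -/(el_p t i) el_p_mul. Qed.

Lemma star_mul_neq i j : i != j -> cstar (t i) ** t j = 0.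
Proof.
move=> ij; rewrite -(star_mul_el_p i) -(el_p_mul j) cmulA -[_ ** _ ** el_p t j]cmulA.
by rewrite (el_p_orth tP ij) cmulr0 cmul0r.
Qed.

Lemma el_q_le i j : i <= j -> q i ** q j = q i.
Proof.
move=> ij; have := el_prod1 i j (q i).
rewrite [X in _ = X ** _]fsbig1 ?cmul0r; last first.
  by move=> k _; rewrite (_ : (_ < _ <= _) = false) ?scale0r//; lia.
rewrite cmulDr cmulrN el_q_idem (el_qC tP j i) cmulA el_q_idem.
by move/eqP; rewrite subr_eq0 => /eqP <-.
Qed.

Lemma el_q_ge i j : i <= j -> q j ** q i = q i.
Proof. by move=> ij; rewrite (el_qC tP) el_q_le. Qed.

(** The case X = {i}, Y = {i - 1}: only p_i is left in the sum. *)
Lemma el_q_split i : q i = el_p t i + q (i - 1).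
Proof.
have := el_prod1 i (i - 1) (q i).
rewrite -(@fsbig_widen _ _ _ _ [set i])//; last first.
  move=> k /= [_ /eqP ki]; rewrite (_ : (_ < _ <= _) = false) ?scale0r//.
  by apply: contraNF ki; lia.
rewrite fsbig_set1 (_ : (_ < _ <= _) = true) ?scale1r; last by lia.
rewrite cmulDr cmulrN el_q_idem el_q_le; last by lia.
rewrite el_q_ge; last by lia.
rewrite /el_p -cmulA star_mul_el_q lexx => <-.
by rewrite subrK.
Qed.


Lemma el_norm_le1 i : cnorm (t i) <= 1.
Proof.
have : cnorm (q i) <= 1 by apply: cnorm_proj_le1; rewrite star_el_q el_q_idem.
rewrite /el_q cnorm_sqr => t1; have := cnorm_ge0 (t i); nra.
Qed.

End Family.

(** * Decreasing words *)
Definition decreasing (w : seq int) := pairwise (fun i j => j <= i) w.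

(** The decreasing words of length at most [L] with letters in b < i <= b + k.
    The recursion, according as the top letter b + k begins the word or does not
    occur in it, is that of the splitting q_(b+k) = s q_(b+k) s^* + q_(b+k-1). *)
Fixpoint words (b : int) (L : nat) : nat -> seq (seq int) :=
  if L is L'.+1 then
    fix words_lt k := if k is k'.+1 then
      [seq (b + k%:Z) :: w | w <- words b L' k] ++ words_lt k'
    else [:: [::]]
  else fun=> [:: [::]].

Lemma words0 b k : words b 0 k = [:: [::]].
Proof. by []. Qed.

Lemma wordsS0 b L : words b L 0 = [:: [::]].
Proof. by case: L. Qed.

Lemma wordsSS b L k : words b L.+1 k.+1 =
  [seq (b + k.+1%:Z) :: w | w <- words b L k.+1] ++ words b L.+1 k.
Proof. by []. Qed.

Lemma words_ind (P : nat -> nat -> Prop) :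
  (forall k, P 0 k) -> (forall L, P L 0) ->
  (forall L k, P L k.+1 -> P L.+1 k -> P L.+1 k.+1) -> forall L k, P L k.
Proof. by move=> P0 Pn PS; elim=> // L IHL; elim=> // k IHk; exact: PS. Qed.

Lemma mem_words b L k w : (w \in words b L k) =
  [&& (size w <= L)%N, decreasing w & all (fun i => b < i <= b + k%:Z) w].
Proof.
move: L k w; apply: words_ind => [k|L|L k IHL IHk] w.
- by rewrite words0 inE; case: w.
- rewrite wordsS0 inE; case: w => // i w /=.
  by apply/esym/negbTE; rewrite !negb_and; case: leP => /= [|?]; rewrite ?orbT//; lia.
rewrite wordsSS mem_cat IHk; case: w => [|i w]; first by rewrite orbT.
have -> : (i :: w \in [seq (b + k.+1%:Z) :: w | w <- words b L k.+1]) =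
    (i == b + k.+1%:Z) && (w \in words b L k.+1).
  apply/mapP/andP => [[u ? [-> ->]]|[/eqP -> ?]]; first by rewrite eqxx.
  by exists w.
rewrite IHL /= ltnS; case: (size w <= L)%N; rewrite ?andbF//=.
case: (decreasing w); rewrite ?andbF//=.
have [->|ik] := eqVneq i (b + k.+1%:Z) => /=.
  rewrite [X in _ || X](_ : _ = false) ?orbF; last by lia.
  rewrite [X in _ = _ && (X && _)](_ : _ = true); last by lia.
  rewrite /=; apply/idP/andP => [wk|[]//]; split=> //.
  by rewrite andbT; apply: sub_all wk => j /=; lia.
rewrite !andbT; apply/idP/idP => /and3P[iw ib wk]; apply/and3P.
  by split=> //; [lia|apply: sub_all wk => j /=; lia].
split=> //; first by lia.
apply/allP => j jw; have := allP wk j jw; have := allP iw j jw => /=; lia.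
Qed.

Lemma uniq_words b L k : uniq (words b L k).
Proof.
move: L k; apply: words_ind => [//|[]//|L k IHL IHk].
rewrite wordsSS cat_uniq IHk map_inj_uniq ?IHL//; last by move=> ? ? [].
rewrite andbT; apply/hasPn => w; rewrite mem_words => /and3P[_ _ wk].
by apply/mapP => -[u _ wE]; move: wk; rewrite wE /=; lia.
Qed.

(** Decreasing words are multisets, so their number grows only polynomially in
    the length; this is what makes the tensor power trick applicable. *)
Lemma size_words b L k : (size (words b L k) <= L.+1 ^ k)%N.
Proof.
move: L k; apply: words_ind => [k|[]//|L k IHL IHk]; first by rewrite exp1n.
rewrite wordsSS size_cat size_map (leq_trans (leq_add IHL IHk))//.
rewrite (expnS L.+2) mulSn addnC leq_add2l expnS leq_mul2l.
by case: k {IHL IHk} => [|k] //; rewrite leq_exp2r// leqnSn orbT.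
Qed.

(** [(i, false)] stands for the i-th generator, [(i, true)] for its adjoint. *)
Notation letter := (int * bool)%type.

Section Words.
Context {R : realType} {B : cstarAlgType R} (t : int -> B).
Implicit Types (i j k b : int) (x y z : B) (u v w : seq int) (l : letter).

Local Notation q := (el_q t).

(** Left multiplication by t_w = t_(w_1) ... t_(w_n); acting on [z] gives a
    meaning to the empty word in a C*-algebra without unit. *)
Definition tmul w z : B := foldr (fun i z => t i ** z) z w.

Lemma tmul_cat u v z : tmul (u ++ v) z = tmul u (tmul v z).
Proof. exact: foldr_cat. Qed.

Lemma tmulM w z x : tmul w z ** x = tmul w (z ** x).
Proof. by elim: w => //= i w IH; rewrite -cmulA IH. Qed.

Lemma tmul_sum (J : Type) (r : seq J) (P : pred J) (F : J -> B) w :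
  tmul w (\sum_(j <- r | P j) F j) = \sum_(j <- r | P j) tmul w (F j).
Proof. by elim: w => //= i w ->; rewrite cmul_sumr. Qed.

Lemma tmul0 w : tmul w 0 = 0.
Proof. by elim: w => //= i w ->; rewrite cmulr0. Qed.

(** The element t_u x t_v^*. *)
Definition tmx u x v : B := tmul u (cstar (tmul v (cstar x))).

Lemma tmx_cat u v u' v' x : tmx (u ++ u') x (v ++ v') = tmx u (tmx u' x v') v.
Proof.
rewrite /tmx !tmul_cat; congr tmul; move: (tmul v' _) => z.
elim: v => /= [|i v IH]; first by rewrite cstarK.
by rewrite !cstarM -tmulM IH.
Qed.
End Words.

(** * Reduction of monomials *)

(** [(u, k, v)] encodes t_u q_k t_v^*. *)
Definition triple : Type := seq int * int * seq int.

Definition letter_in (b c : int) (l : letter) : bool := b < l.1 <= c.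

Definition red_letter (l : letter) : triple :=
  if l.2 then ([::], l.1, [:: l.1]) else ([:: l.1], l.1, [::]).

(** The reduction of l t_u q_k t_v^*, where [None] encodes 0. *)
Definition red_cons (l : letter) (T : triple) : option triple :=
  let: (i, starred) := l in let: (u, k, v) := T in
  if starred then
    if u is j :: u' then if j == i then Some (u', k, v) else None
    else if i <= k then Some ([::], i, rcons v i) else None
  else
    if u is j :: _ then if j <= i then Some (i :: u, k, v) else None
    else Some ([:: i], Order.min i k, v).

Fixpoint red (l : letter) (m : seq letter) : option triple :=
  if m is l' :: m' then obind (red_cons l) (red l' m') else Some (red_letter l).

(** That [k] is at most the last letters of [u] and [v] means that q_k is not
    absorbed by t_u or t_v, which makes the reductions below exact. *)
Definition triple_in (b c : int) (d : nat) (T : triple) : bool :=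
  let: (u, k, v) := T in
  [&& decreasing (rcons u k), decreasing (rcons v k), b < k <= c,
      all (fun i => b < i <= c) u, all (fun i => b < i <= c) v,
      (size u <= d)%N & (size v <= d)%N].

(** In the Fock space, t_u0 q_k t_v0^* sends the basis vector of v0 ++ w to that
    of u0 ++ w if all letters of w are at most k, and kills the other basis
    vectors; [entry] is its matrix. *)
Definition entry (T : triple) (u v : seq int) : bool :=
  let: (u0, k, v0) := T in let w := drop (size v0) v in
  [&& prefix v0 v, u == u0 ++ w & all (fun i => i <= k) w].

Lemma decreasing_rcons w i :
  decreasing (rcons w i) = all (fun j => i <= j) w && decreasing w.
Proof. by rewrite /decreasing pairwise_rcons. Qed.

Lemma red_letter_in b c l : letter_in b c l -> triple_in b c 1 (red_letter l).
Proof. by case: l => i []; rewrite /letter_in /= => ic; rewrite ic ?lexx. Qed.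

Lemma red_cons_in b c d l T T' : letter_in b c l -> triple_in b c d T ->
  red_cons l T = Some T' -> triple_in b c d.+1 T'.
Proof.
case: l => i /=; case: T => -[u k] v st; rewrite /letter_in /= => ic /and5P[uk vk kc uc /and3P[vc ud vd]].
have vd' : (size v <= d.+1)%N by lia.
have ud' : (size u <= d.+1)%N by lia.
move: uk vk; rewrite !decreasing_rcons => /andP[uk du] /andP[vk dv].
case: st; case: u uk du uc ud ud' => [_ _ _ _ _|j u /= /andP[jk uk] /andP[ju du] /andP[jc uc] ud ud'].
- case: ifP => // ik [<-] /=.
  have vi : all (fun j => i <= j) v by apply/allP => j /(allP vk); apply: le_trans.
  by rewrite !decreasing_rcons !all_rcons size_rcons lexx vi dv ic vc ltnS vd.
- case: ifP => // /eqP ij [<-] /=; rewrite !decreasing_rcons uk du vk dv kc uc vc vd'.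
  by rewrite /=; lia.
- case=> <- /=; rewrite !decreasing_rcons ic dv vc vd' /=.
  have vk' : all (fun j => Order.min i k <= j) v.
    by apply/allP => j /(allP vk); apply: le_trans; rewrite ge_min lexx orbT.
  by rewrite vk' ge_min lexx /=; lia.
- case: ifP => // ji [<-] /=; rewrite !decreasing_rcons /= !all_rcons.
  rewrite uk jk ju du vk dv kc ic jc uc vc vd' ltnS ud ji (le_trans jk ji) /= !andbT.
  by apply/allP => x /(allP ju) xj; apply: le_trans ji.
Qed.

Lemma red_in b c l m T : all (letter_in b c) (l :: m) ->
  red l m = Some T -> triple_in b c (size m).+1 T.
Proof.
elim: m l T => [|l' m IH] l T /=.
  by rewrite andbT => lc [<-]; apply: red_letter_in.
move=> /andP[lc mc]; case E: (red l' m) => [T'|//] /=.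
by apply: red_cons_in => //; apply: IH E.
Qed.

Section Monomials.
Context {R : realType} {B : cstarAlgType R} (t : int -> B).
Implicit Types (i j k b : int) (x y z : B) (u v w : seq int) (l : letter).

Local Notation q := (el_q t).
Local Notation tmul := (tmul t).
Local Notation tmx := (tmx t).

Definition leval l : B := if l.2 then cstar (t l.1) else t l.1.

Fixpoint mono l (m : seq letter) : B :=
  if m is l' :: m' then leval l ** mono l' m' else leval l.

Definition tripval (T : triple) : B := tmx T.1.1 (q T.1.2) T.2.

Hypothesis tP : exel_laca_family wm_matrix t.

Lemma mul_el_q_ge i k : i <= k -> t i ** q k = t i.
Proof. by move=> ik; rewrite -(mul_el_q tP i) -cmulA el_q_le. Qed.

Lemma tripvalE u k v : tripval (u, k, v) = tmul u (cstar (tmul v (q k))).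
Proof. by rewrite /tripval /tmx star_el_q. Qed.

Lemma leval_tripval b c d l T : triple_in b c d T ->
  leval l ** tripval T = oapp tripval 0 (red_cons l T).
Proof.
case: T => -[u k] v; case: l => i st; rewrite /triple_in decreasing_rcons.
move=> /andP[/andP[uk du] _]; rewrite tripvalE /leval /red_cons.
case: st => /=; case: u uk du => [|j u] /= uk du.
- rewrite -cstarM tmulM el_q_mul//; case: ifP => _ /=; last by rewrite tmul0 cstar0.
  by rewrite tripvalE -cats1 tmul_cat /= mul_el_q_ge.
- rewrite cmulA; have [?|ji] := eqVneq j i; last first.
    by rewrite star_mul_neq 1?eq_sym// cmul0r.
  subst j; rewrite /= tripvalE -/(el_q t i); case: u uk du => [|j' u] /= uk du.
    by rewrite -(star_el_q t i) -cstarM tmulM el_q_le//; case/andP: uk.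
  by rewrite cmulA el_q_mul// ifT//; case/andP: du => /andP[].
- rewrite tripvalE /= -[t i]cstarK -!cstarM !tmulM; case: leP => // ik.
  congr (cstar (tmul v _)); rewrite -(star_el_q t i) -(star_el_q t k).
  by rewrite -!cstarM !mul_el_q_ge.
- rewrite -[t i](mul_el_q tP) -cmulA [q i ** _]cmulA el_q_mul//.
  case: ifP => ji /=; last by rewrite cmul0r cmulr0.
  by rewrite tripvalE.
Qed.

(** A monomial reduces in the same way in all families, whatever the algebra. *)
Lemma monoE b c l m : all (letter_in b c) (l :: m) ->
  mono l m = oapp tripval 0 (red l m).
Proof.
elim: m l => [|l' m IH] l /=.
  move=> _; rewrite /leval /red_letter; case: ifP => _.
    by rewrite tripvalE /= mul_el_q.
  by rewrite tripvalE /= star_el_q mul_el_q.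
move=> /andP[lc mc]; rewrite (IH _ mc); case E: (red l' m) => [T|] /=.
  exact: leval_tripval (red_in mc E).
by rewrite cmulr0.
Qed.

End Monomials.

(** * Compressing monomials to scalars *)
Section Compression.
Context {R : realType} {B : cstarAlgType R} (t : int -> B).
Implicit Types (i j k b : int) (x y z : B) (u v w : seq int) (l : letter).

Local Notation q := (el_q t).
Local Notation tmul := (tmul t).
Local Notation tripval := (tripval t).

(** Left multiplication by t_u^*. *)
Definition smul u z : B := foldl (fun z i => cstar (t i) ** z) z u.

(** The element q_b t_u^* z t_v q_b.  When the letters are all greater than [b],
    the t_u q_b t_v^* are matrix units over the corner of q_b. *)
Definition compress b u v z : B := q b ** smul u (z ** tmul v (q b)).

Lemma smul0 u : smul u 0 = 0.
Proof. by elim: u => //= i u; rewrite cmulr0. Qed.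

Lemma smulD u x y : smul u (x + y) = smul u x + smul u y.
Proof. by elim: u x y => //= i u IH x y; rewrite cmulDr IH. Qed.

Lemma smulZ u (a : R[i]) x : smul u (a *: x) = a *: smul u x.
Proof. by elim: u x => //= i u IH x; rewrite cmulZr IH. Qed.

Lemma compress0 b u v : compress b u v 0 = 0.
Proof. by rewrite /compress cmul0r smul0 cmulr0. Qed.

Lemma compressD b u v x y :
  compress b u v (x + y) = compress b u v x + compress b u v y.
Proof. by rewrite /compress cmulDl smulD cmulDr. Qed.

Lemma compressZ b u v (a : R[i]) x :
  compress b u v (a *: x) = a *: compress b u v x.
Proof. by rewrite /compress cmulZl smulZ cmulZr. Qed.

Hypothesis tP : exel_laca_family wm_matrix t.

Lemma cnorm_tmul w z : cnorm (tmul w z) <= cnorm z.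
Proof.
elim: w => //= i w IH; apply: le_trans (cnormM _ _) _.
by rewrite (le_trans _ IH)// ler_piMl ?cnorm_ge0 ?el_norm_le1.
Qed.

Lemma cnorm_smul w z : cnorm (smul w z) <= cnorm z.
Proof.
elim: w z => //= i w IH z; apply: le_trans (IH _) _.
apply: le_trans (cnormM _ _) _.
by rewrite cnorm_star ler_piMl ?cnorm_ge0 ?el_norm_le1.
Qed.

Lemma el_q_norm_le1 i : cnorm (q i) <= 1.
Proof. by apply: cnorm_proj_le1; rewrite star_el_q el_q_idem. Qed.

Lemma cnorm_compress b u v z : cnorm (compress b u v z) <= cnorm z.
Proof.
apply: le_trans (cnormM _ _) _.
apply: (@le_trans _ _ (1 * cnorm z)); last by rewrite mul1r.
apply: ler_pM; rewrite ?cnorm_ge0 ?el_q_norm_le1//.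
apply: le_trans (cnorm_smul _ _) _; apply: le_trans (cnormM _ _) _.
rewrite ler_piMr ?cnorm_ge0//.
by apply: le_trans (cnorm_tmul _ _) _; exact: el_q_norm_le1.
Qed.

(** Both sides are q_b t_w^* y^*; the right one has no empty product. *)
Lemma smul_star w y b : q b ** smul w (cstar y) = cstar (y ** tmul w (q b)).
Proof.
elim: w y => [|i w IH] y /=; first by rewrite cstarM star_el_q.
by rewrite -cstarM IH cmulA.
Qed.

Lemma smul_el_q b i w z : b <= i -> all (fun j => j <= i) w ->
  q b ** smul w (q i ** z) = q b ** smul w z.
Proof.
case: w => [|j w] /= bi; first by rewrite cmulA el_q_le.
by move=> /andP[ji _]; rewrite cmulA star_mul_el_q// ji.
Qed.

(** The product t_u^* t_w vanishes unless one word is a prefix of the other, and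
    when [w] is strictly longer the next letter of [w], being greater than [b],
    is killed by q_b. *)
Lemma smul_tmul b u w z : decreasing u ->
    all (fun i => b < i) u -> all (fun i => b < i) w ->
  q b ** smul u (tmul w z) =
    if prefix w u then q b ** smul (drop (size w) u) z else 0.
Proof.
elim: u w => [|i u IH] [|j w] //= du bu /andP[bj bw].
  by rewrite cmulA el_q_mul// leNgt bj cmul0r.
 move: du bu => /andP[ui du] /andP[bi bu].
rewrite cmulA; have [?|ij] := eqVneq j i; last first.
  by rewrite star_mul_neq 1?eq_sym// cmul0r smul0 cmulr0.
by subst j; rewrite -/(el_q t i) smul_el_q// 1?ltW// IH.
Qed.

Lemma el_q_tmul b k w : b <= k -> decreasing w ->
  q k ** tmul w (q b) = if all (fun i => i <= k) w then tmul w (q b) else 0.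
Proof.
case: w => [|i w] /= bk; first by rewrite el_q_ge.
move=> /andP[wi _]; rewrite cmulA el_q_mul//; case: ifP => ik /=; last by rewrite cmul0r.
rewrite ifT//; apply/allP => j /(allP wi) ji; exact: le_trans ik.
Qed.

(** Compression by q_b only sees the part of the family that looks like the Fock
    space, whence the matrix entries are those of [entry]; the rest, such as the
    unitary part in the Wold decomposition of an isometry t_i, is cut off. *)
Lemma compress_tripval b c d u v T : triple_in b c d T ->
    decreasing u -> decreasing v ->
    all (fun i => b < i) u -> all (fun i => b < i) v ->
  compress b u v (tripval T) = (entry T u v)%:R *: q b.
Proof.
case: T => -[a k] w; rewrite /triple_in tripvalE.
move=> /and5P[_ _ /andP[bk _] ac /and3P[wc _ _]] du dv bu bv.
have ba : all (fun i => b < i) a by apply: sub_all ac => i /andP[].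
have bw : all (fun i => b < i) w by apply: sub_all wc => i /andP[].
set v' := drop (size w) v.
have dv' : decreasing v' by apply: subseq_pairwise dv; exact: drop_subseq.
have bv' : all (fun i => b < i) v'.
  by apply/allP => i /mem_drop /(allP bv).
have wv : cstar (tmul w (q k)) ** tmul v (q b) =
    if prefix w v && all (fun i => i <= k) v' then tmul v' (q b) else 0.
  rewrite -[LHS]cstarK -smul_star cstarK smul_tmul//; case: ifP => _ /=; last exact: cstar0.
  by rewrite -(star_el_q t k) smul_star cstarK el_q_tmul// ltW.
rewrite /compress tmulM wv /entry -/v' andbCA.
case: ifP => _; last by rewrite tmul0 smul0 cmulr0 andbF scale0r.
rewrite andbT -tmul_cat smul_tmul ?all_cat ?ba//.
case: ifP => [|nau]; last first.
  rewrite (_ : (u == _) = false) ?scale0r//; apply: contraFF nau => /eqP ->.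
  exact: prefix_refl.
move=> /prefixP[r uE]; move: bu; rewrite uE drop_size_cat// all_cat => /andP[_].
case: r {uE} => [|i r] /=; first by rewrite cats0 eqxx scale1r el_q_idem.
move=> /andP[bi _]; rewrite star_mul_el_q// leNgt bi smul0 cmulr0.
rewrite (_ : (_ == _) = false) ?scale0r//.
by apply/negbTE; rewrite -{2}[_ ++ v']cats0 eqseq_cat// eqxx.
Qed.

End Compression.

(** * The tensor power trick *)
Section Growth.
Context {R : realType}.
Implicit Types (a b h r : R).

Lemma bernoulli_ineq h n : 0 <= h -> 1 + h *+ n <= (1 + h) ^+ n.
Proof.
move=> h0; elim: n => [|n IH]; first by rewrite mulr0n addr0 expr0.
rewrite exprS (le_trans _ (ler_wpM2l _ IH)) ?addr_ge0//.
by rewrite mulrDr mulr1 mulrDl mul1r mulrS -addrA !lerD2l lerDl mulr_ge0// mulrn_wge0.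
Qed.

(** An inequality up to a polynomial factor that is stable under powers holds
    without the factor: if b < a, then (a / b)^(2^n) outgrows every polynomial
    in 2^n. *)
Lemma tensor_power_trick a b p d : 0 <= a -> 0 <= b ->
  (forall n, a ^+ (2 ^ n) <= ((d * 2 ^ n + 2) ^ p)%:R * b ^+ (2 ^ n)) ->
  a <= b.
Proof.
move=> a0; rewrite le_eqVlt => /predU1P[<-|b0] H.
  by have := H 0; rewrite !expr1 mulr0.
rewrite leNgt; apply/negP => ba.
pose h := a / b - 1.
have h0 : 0 < h by rewrite subr_gt0 ltr_pdivlMr// mul1r.
pose K : R := ((d + 2) ^ p * 2 ^ (p * p))%:R.
suff hK m : (2 ^ m)%:R * h ^+ p.+1 <= K.
  have [m] : exists m, K / h ^+ p.+1 < m%:R.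
    by exists (Num.truncn (K / h ^+ p.+1)).+1; rewrite truncnS_gt.
  rewrite ltr_pdivrMr ?exprn_gt0// ltNge => /negP; apply.
  apply: le_trans (hK m); rewrite ler_pM2r ?exprn_gt0// ler_nat.
  exact/ltnW/ltn_expl.
have aE : a = (1 + h) * b by rewrite /h addrC subrK divfK ?gt_eqF.
have := H (m + p)%N; rewrite {1}aE exprMn ler_pM2r ?exprn_gt0//.
(* The exponent 2^m is raised to the power 2^p > p, one factor more than the
   p factors of the polynomial bound. *)
rewrite expnD exprM => H1.
have h1 : 1 <= (1 + h) ^+ (2 ^ m) by rewrite exprn_ege1// lerDl ltW.
have : ((2 ^ m)%:R * h) ^+ p.+1 <= ((d * (2 ^ m * 2 ^ p) + 2) ^ p)%:R.
  apply: le_trans H1; apply: le_trans (_ : ((1 + h) ^+ (2 ^ m)) ^+ p.+1 <= _).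
    apply: lerXn2r; rewrite ?nnegrE ?(le_trans ler01 h1) ?mulr_ge0 ?(ltW h0)//.
    have := bernoulli_ineq (2 ^ m) (ltW h0).
    by apply: le_trans; rewrite mulr_natl lerDr.
  by rewrite ler_weXn2l// ltn_expl.
rewrite exprMn => H2.
have m0 : 0 < ((2 ^ m) ^ p)%:R :> R by rewrite ltr0n !expn_gt0.
rewrite -(ler_pM2l m0) mulrA -natrM -expnSr natrX; apply: le_trans H2 _.
rewrite -natrM ler_nat !expnM -!expnMn.
have MP0 : (0 < 2 ^ m * 2 ^ p)%N by rewrite muln_gt0 !expn_gt0.
by clear -MP0; case: p MP0 => // p MP0; rewrite leq_exp2r//; nia.
Qed.
End Growth.


(** * Polynomials in the generators and their adjoints *)
Section Polynomials.
Context {R : realType}.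

(** Linear combinations of nonempty monomials, the algebras having no unit. *)
Definition starpoly : Type := seq (R[i] * (letter * seq letter)).

Definition peval {B : cstarAlgType R} (t : int -> B) (y : starpoly) : B :=
  \sum_(m <- y) m.1 *: mono t m.2.1 m.2.2.

Definition polyZ (a : R[i]) (y : starpoly) : starpoly := [seq (a * m.1, m.2) | m <- y].

Definition polyM (y z : starpoly) : starpoly :=
  [seq (m.1 * n.1, (m.2.1, m.2.2 ++ n.2.1 :: n.2.2)) | m <- y, n <- z].

Definition letterV (l : letter) : letter := (l.1, ~~ l.2).

Fixpoint monoV (l : letter) (m : seq letter) : letter * seq letter :=
  if m is l' :: m' then
    let: (l0, m0) := monoV l' m' in (l0, rcons m0 (letterV l))
  else (letterV l, [::]).

Definition polyV (y : starpoly) : starpoly :=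
  [seq (conjc m.1, monoV m.2.1 m.2.2) | m <- y].

Definition poly_in (b c : int) (d : nat) (y : starpoly) : bool :=
  all (fun m => all (letter_in b c) (m.2.1 :: m.2.2) &&
                (size m.2.2 < d)%N) y.

Lemma monoV_in b c l m :
  all (letter_in b c) ((monoV l m).1 :: (monoV l m).2) =
    all (letter_in b c) (l :: m) /\ size (monoV l m).2 = size m.
Proof.
elim: m l => [|l' m IH] l //=; have := IH l'; case: (monoV l' m) => l0 m0 /= [E sE].
by rewrite all_rcons size_rcons /= [in LHS]andbCA E sE.
Qed.

Lemma polyM_in b c d e y z : poly_in b c d y -> poly_in b c e z ->
  poly_in b c (d + e) (polyM y z).
Proof.
move=> /allP yd /allP ze; apply/allP => _ /allpairsP[[m n] /= [my nz ->]] /=.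
have /= /andP[/andP[ml mm] ms] := yd _ my; have /= /andP[nl ns] := ze _ nz.
rewrite ml all_cat mm size_cat /=; move: nl => /andP[-> ->] /=; lia.
Qed.

Lemma polyV_in b c d y : poly_in b c d y -> poly_in b c d (polyV y).
Proof.
move=> /allP yd; apply/allP => _ /mapP[m /= my ->].
by have [E sE] := monoV_in b c m.2.1 m.2.2; have := yd _ my; rewrite /= -[X in X && _]/(all _ (_ :: _)) -E -sE.
Qed.

Lemma poly_in_exists (y : starpoly) : exists (b : int) (k d : nat), poly_in b (b + k%:Z) d y.
Proof.
elim: y => [|[a [l m]] y [b [k [d yb]]]]; first by exists 0, 0, 0.
have [b' [k' lb]] : exists (b' : int) (k' : nat),
      all (letter_in b' (b' + k'%:Z)) (l :: m).
  elim: (l :: m) => [|l' m' [b' [k' mb]]]; first by exists 0, 0.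
  exists (b' - `|b' - l'.1|%:Z - 1), (k' + (`|b' - l'.1| + 1) * 2)%N => /=.
  apply/andP; split; first by rewrite /letter_in; lia.
  by apply: sub_all mb => x; rewrite /letter_in; lia.
exists (b - `|b - b'|%:Z), (k + k' + `|b - b'| * 2)%N, (d + (size m).+1)%N => /=.
apply/andP; split; last first.
  apply: sub_all yb => x /andP[xb xd]; apply/andP; split; last by lia.
  by apply: sub_all xb => z; rewrite /letter_in; lia.
apply/andP; split; last by lia.
by have := sub_all _ lb; apply => z; rewrite /letter_in; lia.
Qed.

Section Eval.
Context {B : cstarAlgType R} (t : int -> B).
Implicit Types (y z : starpoly) (l : letter) (m : seq letter).

Local Notation mono := (mono t).
Local Notation ev := (peval t).

Lemma mono_cat l m l' m' : mono l (m ++ l' :: m') = mono l m ** mono l' m'.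
Proof. by elim: m l => [|k m IH] l //=; rewrite IH cmulA. Qed.

Lemma leval_star l : leval t (letterV l) = cstar (leval t l).
Proof. by rewrite /leval; case: l => i [] /=; rewrite ?cstarK. Qed.

Lemma mono_star l m : mono (monoV l m).1 (monoV l m).2 = cstar (mono l m).
Proof.
elim: m l => [|l' m IH] l /=; first exact: leval_star.
have := IH l'; case: (monoV l' m) => l0 m0 /= E.
by rewrite -cats1 mono_cat E cstarM /= leval_star.
Qed.

Lemma peval_cat y z : ev (y ++ z) = ev y + ev z.
Proof. exact: big_cat. Qed.

Lemma pevalZ a y : ev (polyZ a y) = a *: ev y.
Proof.
rewrite /peval big_map scaler_sumr; apply: eq_bigr => m _.
by rewrite scalerA.
Qed.

Lemma pevalM y z : ev (polyM y z) = ev y ** ev z.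
Proof.
rewrite /polyM /peval big_allpairs_dep cmul_suml; apply: eq_bigr => m _.
rewrite cmul_sumr; apply: eq_bigr => n _ /=.
by rewrite mono_cat cmulZl cmulZr scalerA.
Qed.

Lemma pevalV y : ev (polyV y) = cstar (ev y).
Proof.
rewrite /peval big_map cstar_sum; apply: eq_bigr => m _.
by rewrite cstarZ mono_star.
Qed.

Lemma peval1 i : ev [:: (1, ((i, false), [::]))] = t i.
Proof. by rewrite /peval big_seq1 scale1r. Qed.

(** The 2^n-th power of y^* y, by repeated squaring. *)
Definition polyX (n : nat) y : starpoly := iter n (fun z => polyM z z) (polyM (polyV y) y).

Lemma polyX_in b c d n y : poly_in b c d y -> poly_in b c (d * 2 ^ n.+1) (polyX n y).
Proof.
move=> yd; elim: n => [|n IH]; first by rewrite expn1 muln2 -addnn polyM_in ?polyV_in.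
by rewrite expnS mulnCA mul2n -addnn; exact: polyM_in.
Qed.

(** Each square is that of a selfadjoint element, so the C*-identity applies. *)
Lemma peval_polyX n y : cstar (ev (polyX n y)) = ev (polyX n y) /\
  cnorm (ev (polyX n y)) = cnorm (ev y) ^+ (2 ^ n.+1).
Proof.
elim: n => [|n [IHs IHn]] /=; rewrite pevalM.
  by rewrite pevalV cstarM cstarK cnorm_sqr.
split; first by rewrite cstarM IHs.
by rewrite -[X in X ** _]IHs cnorm_sqr IHn -exprM -expnSr.
Qed.

End Eval.
End Polynomials.
Arguments starpoly R : clear implicits.

(** * The norm inequality between two families *)
Section Expansion.
Context {R : realType}.

(** The index of the projection in the middle of a layer: words shorter than [N]
    are followed by letters at most [b] only, words of length [N] by any letter
    that may follow them. *)
Definition leaf (b : int) (N : nat) (c : int) (s : nat) (v : seq int) : int :=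
  if (s < N)%N then b else last c v.

(** The default [0] of the last letter is never met: when the longer word has
    length N > 0 in the expansion of a monomial of degree less than N, both words
    end with the same letter. *)
Definition theta {B : cstarAlgType R} (t : int -> B) b N (p : seq int * seq int) : B :=
  tmx t p.1 (el_q t (leaf b N 0 (maxn (size p.1) (size p.2)) p.2)) p.2.

Definition window b (k N : nat) : seq (seq int * seq int) :=
  [seq (u, v) | u <- words b N k, v <- words b N k].

Lemma uniq_window b k N : uniq (window b k N).
Proof. by apply: allpairs_uniq; rewrite ?uniq_words// => -[? ?] [? ?]. Qed.

(** The nonzero entries of a triple sit at the pairs with a common suffix. *)
Lemma window_entry b k N d T : triple_in b (b + k%:Z) d T -> (d < N)%N ->
  let n := (N - maxn (size T.1.1) (size T.2))%N in
  perm_eq [seq p <- window b k N | entry T p.1 p.2]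
    [seq (T.1.1 ++ w, T.2 ++ w) | w <- words b n `|T.1.2 - b|%N].
Proof.
case: T => -[a l] c; rewrite /triple_in !decreasing_rcons /=.
move=> /and5P[/andP[al da] /andP[cl dc] /andP[bl lk] ak /and3P[ck ad cd]] dN.
set n := (N - _)%N.
apply: uniq_perm; first by rewrite filter_uniq ?uniq_window.
  rewrite map_inj_uniq ?uniq_words// => w w' [/eqP + _].
  by rewrite eqseq_cat// eqxx => /eqP.
have lE : b + `|l - b|%N%:Z = l by lia.
move=> [u v]; rewrite mem_filter; apply/andP/mapP => /=.
  move=> [/and3P[/prefixP[w vE] /eqP uE wl] /allpairsP[[u' v'] /= [uw vw]]].
  move=> [uu' vv']; subst u' v'; move: uE wl; rewrite {1 2}vE drop_size_cat// => uE wl.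
  exists w; last by rewrite uE vE.
  move: uw vw; rewrite uE vE !mem_words !size_cat !all_cat.
  move=> /and3P[us _ _] /and3P[vs + /andP[_ wk]].
  rewrite /decreasing pairwise_cat => /and3P[_ _ ->] /=; rewrite lE.
  apply/andP; split.
    by rewrite leq_subRL ?addn_maxl ?geq_max ?us ?vs//; lia.
  by apply/allP => i iw; rewrite (allP wl i iw) andbT; have /andP[] := allP wk i iw.
move=> [w + [-> ->]]; rewrite mem_words lE => /and3P[wn dw wbl].
have /andP[wa wc] : (size a + size w <= N)%N && (size c + size w <= N)%N.
  by move: wn; rewrite leq_subRL ?addn_maxl ?geq_max//; lia.
have wl : all (fun i => i <= l) w by apply: sub_all wbl => i /andP[].
have wk : all (fun i => b < i <= b + k%:Z) w.
  by apply: sub_all wbl => i /andP[-> il]; exact: le_trans lk.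
split; first by rewrite prefix_prefix drop_size_cat// eqxx wl.
apply/allpairsP; exists (a ++ w, c ++ w); split=> //=.
  rewrite mem_words size_cat all_cat ak wk wa /= !andbT.
  rewrite /decreasing pairwise_cat -!/(decreasing _) da dw !andbT.
  by apply/allrelP => i j /(allP al) li /(allP wl) jl; exact: le_trans li.
rewrite mem_words size_cat all_cat ck wk wc /= !andbT.
rewrite /decreasing pairwise_cat -!/(decreasing _) dc dw !andbT.
by apply/allrelP => i j /(allP cl) li /(allP wl) jl; exact: le_trans li.
Qed.

Definition coef (y : starpoly R) (p : seq int * seq int) : R[i] :=
  \sum_(m <- y) m.1 * (oapp (fun T => entry T p.1 p.2) false (red m.2.1 m.2.2))%:R.

Section OneFamily.
Context {B : cstarAlgType R} (t : int -> B).
Hypothesis tP : exel_laca_family wm_matrix t.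
Local Notation q := (el_q t).

(** In the Fock space picture: a word with letters at most b + k is the longest
    prefix of letters greater than b, or the first N of these letters, followed
    by the rest. *)
Lemma el_q_partition b N k :
  q (b + k%:Z) =
  \sum_(w <- words b N k) tmx t w (q (leaf b N (b + k%:Z) (size w) w)) w.
Proof.
move: N k; apply: words_ind => [k|N|N k IHN IHk].
- by rewrite words0 big_seq1 /tmx /leaf /= cstarK.
- by rewrite wordsS0 big_seq1 /tmx /leaf /= cstarK addr0 if_same.
rewrite wordsSS big_cat big_map /= el_q_split// (_ : _ - 1 = b + k%:Z); last by lia.
congr (_ + _).
  rewrite /el_p -[X in X ** _](mul_el_q tP) IHN cmul_sumr cmul_suml.
  apply: eq_bigr => w _; rewrite /leaf /= ltnS -cmulA.
  by congr (_ ** _); rewrite /tmx tmulM /= -cstarM.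
rewrite IHk; apply: eq_bigr => w _; congr (tmx t w (q _) w).
by rewrite /leaf; case: w.
Qed.

Lemma tripval_expand b k N d T : triple_in b (b + k%:Z) d T -> (d < N)%N ->
  tripval t T = \sum_(p <- window b k N) (entry T p.1 p.2)%:R *: theta t b N p.
Proof.
move=> Tin dN.
transitivity (\sum_(p <- window b k N | entry T p.1 p.2) theta t b N p); last first.
  rewrite big_mkcond; apply: eq_bigr => p _.
  by case: ifP => _; rewrite ?scale1r ?scale0r.
rewrite -big_filter (perm_big _ (window_entry Tin dN)) big_map.
case: T Tin => -[a l] c /= /and5P[_ _ /andP[bl _] _ /and3P[_ ad cd]].
set n := (N - _)%N; have n0 : (0 < n)%N by rewrite /n; lia.
rewrite /tripval /=.
have lE : l = b + `|l - b|%N%:Z by lia.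
rewrite {1}lE (el_q_partition b n) -lE.
rewrite /tmx cstar_sum tmul_sum cstar_sum tmul_sum.
apply: eq_bigr => w _.
rewrite -/(tmx t a _ c) -tmx_cat /theta /=; congr (tmx t _ (q _) _).
rewrite /leaf !size_cat (_ : (maxn _ _ < N)%N = (size w < n)%N); last first.
  by rewrite ltn_subRL addn_maxl.
case: ltnP => // nw; case: w nw => [|i w _]; first by rewrite leqNgt n0.
by rewrite last_cat.
Qed.

Lemma peval_expand b k d N y : poly_in b (b + k%:Z) d y -> (d < N)%N ->
  peval t y = \sum_(p <- window b k N) coef y p *: theta t b N p.
Proof.
move=> yd dN; under eq_bigr do rewrite scaler_suml.
rewrite exchange_big /=; apply: eq_big_seq => m my.
under eq_bigr do rewrite -scalerA.
rewrite -scaler_sumr; congr (_ *: _).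
have /andP[mw ms] := allP yd _ my; rewrite (monoE tP mw).
case E: (red _ _) => [T|] /=; last by rewrite big1// => p _; rewrite scale0r.
by apply: tripval_expand (red_in mw E) _; lia.
Qed.

Lemma cnorm_theta b N p : cnorm (theta t b N p) <= 1.
Proof.
apply: le_trans (cnorm_tmul tP _ _) _; rewrite cnorm_star.
by apply: le_trans (cnorm_tmul tP _ _) _; rewrite star_el_q el_q_norm_le1.
Qed.

Lemma compress_peval b k d N y u v : poly_in b (b + k%:Z) d y ->
    u \in words b N k -> v \in words b N k ->
  compress t b u v (peval t y) = coef y (u, v) *: q b.
Proof.
move=> yd; rewrite !mem_words => /and3P[_ du uk] /and3P[_ dv vk].
have bu : all (fun i => b < i) u by apply: sub_all uk => i /andP[].
have bv : all (fun i => b < i) v by apply: sub_all vk => i /andP[].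
rewrite /peval (big_morph _ (compressD t b u v) (compress0 t b u v)).
rewrite scaler_suml; apply: eq_big_seq => m my.
have /andP[mw ms] := allP yd _ my; rewrite compressZ (monoE tP mw) -scalerA.
congr (_ *: _); case E: (red _ _) => [T|] /=; last by rewrite compress0 scale0r.
exact: compress_tripval (red_in mw E) _ _ _ _.
Qed.

Lemma normc_coef_le b k d N y p : q b != 0 -> poly_in b (b + k%:Z) d y ->
  p \in window b k N -> Normc.normc (coef y p) <= cnorm (peval t y).
Proof.
move=> qb yd /allpairsP[[u v] /= [uw vw ->]].
apply: le_trans (cnorm_compress tP b u v _).
rewrite (compress_peval yd uw vw) cnormZ cnorm_proj ?mulr1//.
by rewrite star_el_q el_q_idem.
Qed.

End OneFamily.

Section TwoFamilies.
Context {B C : cstarAlgType R} (t : int -> B) (s : int -> C).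
Hypotheses (tP : exel_laca_family wm_matrix t).
Hypotheses (sP : exel_laca_family wm_matrix s) (s0 : forall i, el_q s i != 0).

Lemma cnorm_peval_growth b k d y : poly_in b (b + k%:Z) d y ->
  cnorm (peval t y) <= ((d + 2) ^ (k * 2))%:R * cnorm (peval s y).
Proof.
move=> yd; rewrite (peval_expand tP yd (ltnSn d)).
apply: le_trans (cnorm_sum _ _ _) _.
apply: (@le_trans _ _ (\sum_(p <- window b k d.+1) cnorm (peval s y))).
  rewrite big_seq [leRHS]big_seq; apply: ler_sum => p pw; rewrite cnormZ.
  apply: le_trans (normc_coef_le sP (s0 b) yd pw).
  by rewrite ler_piMr ?cnorm_theta//; case: (coef _ _) => ? ?; exact: sqrtr_ge0.
rewrite big_const_seq count_predT iter_addr_0 -[leLHS]mulr_natl.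
rewrite ler_wpM2r ?cnorm_ge0// ler_nat size_allpairs expnM -mulnn addn2.
exact: leq_mul (size_words _ _ _) (size_words _ _ _).
Qed.

(** The C*-identity removes the polynomial factor of [cnorm_peval_growth]. *)
Theorem cnorm_peval_le y : cnorm (peval t y) <= cnorm (peval s y).
Proof.
have [b [k [d yd]]] := poly_in_exists y.
rewrite -(@ler_pXn2r _ 2) ?nnegrE ?cnorm_ge0//.
apply: (@tensor_power_trick _ _ _ (k * 2) (d * 2)); rewrite ?exprn_ge0 ?cnorm_ge0//.
move=> n; have [_ tn] := peval_polyX t n y; have [_ sn] := peval_polyX s n y.
rewrite -!exprM -!expnS -tn -sn -mulnA -expnS.
exact: cnorm_peval_growth (polyX_in n yd).
Qed.

End TwoFamilies.
End Expansion.

(** * Extension to the generated C*-algebra *)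
Section CStarTopology.
Context {R : realType} {B : cstarAlgType R}.
Implicit Types (x y z : B) (D : set B).

Lemma nbhs_cnorm x D :
  nbhs x D <-> exists2 e : R, 0 < e & forall y, cnorm (y - x) < e -> D y.
Proof.
split=> [/nbhs_ballP|[e e0 eD]].
  rewrite /nbhs_ball -ball_normE => -[e /= e0 eD].
  exists (complex.Re e); first by move: e0; rewrite ltcE => /andP[].
  move=> y yx; apply: eD; rewrite /ball_ /= distrC cnormE ltcE /= yx andbT.
  by rewrite eq_sym; apply/eqP; rewrite ger0_Im// ltW.
apply/nbhs_ballP; exists e%:C; first by rewrite /= ltcR.
by move=> y; rewrite -ball_normE /ball_ /= distrC cnormE ltcR; exact: eD.
Qed.

Lemma closure_cnorm D x :
  closure D x <-> forall e : R, 0 < e -> exists2 y, D y & cnorm (y - x) < e.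
Proof.
split=> [Dx e e0|Dx U /nbhs_cnorm[e e0 eU]].
  have /Dx[y [Dy xy]] : nbhs x [set y | cnorm (y - x) < e].
    by apply/nbhs_cnorm; exists e.
  by exists y.
by have [y Dy xy] := Dx _ e0; exists y; split=> //; exact: eU.
Qed.

Lemma cnormM_lt x x' y y' (e d M : R) :
  cnorm x' + cnorm y' + 2 <= M -> d <= 1 -> d * M <= e -> 
  cnorm (x - x') < d -> cnorm (y - y') < d -> cnorm (x ** y - x' ** y') < e.
Proof.
move=> M2 d1 dM xd yd.
rewrite [X in cnorm X](_ : _ = (x - x') ** y + x' ** (y - y')); last first.
  by rewrite cmulDl cmulDr cmulNr cmulrN addrA subrK.
apply: le_lt_trans (cnormD _ _) _.
have n1 := cnormM (x - x') y; have n2 := cnormM x' (y - y').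
have y1 : cnorm y <= cnorm y' + 1.
  rewrite -{1}[y](subrK y') (le_trans (cnormD _ _))// addrC lerD2l.
  by rewrite (le_trans (ltW yd)).
have := cnorm_ge0 x'; have := cnorm_ge0 y; have := cnorm_ge0 y'.
have := cnorm_ge0 (x - x'); have := cnorm_ge0 (y - y').
nra.
Qed.

End CStarTopology.

Section Extension.
Context {R : realType} {B C : cstarAlgType R} (t : int -> B) (s : int -> C).
Hypotheses (tP : exel_laca_family wm_matrix t).
Hypotheses (sP : exel_laca_family wm_matrix s) (s0 : forall i, el_q s i != 0).

(** The closure of the set of pairs (y(s), y(t)): the norm inequality makes it
    the graph of a contraction, and it is a *-subalgebra of the product. *)
Definition ext_graph (x : C) (z : B) : Prop := forall e : R, 0 < e ->
  exists2 y, cnorm (peval s y - x) < e & cnorm (peval t y - z) < e.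

Lemma ext_graph_gen i : ext_graph (s i) (t i).
Proof.
move=> e e0; exists [:: (1, ((i, false), [::]))]; by rewrite peval1 subrr cnorm0.
Qed.

Lemma ext_graph_lin (a : R[i]) x z x' z' : ext_graph x z -> ext_graph x' z' ->
  ext_graph (a *: x + x') (a *: z + z').
Proof.
move=> xz xz' e e0; pose M := Normc.normc a + 1.
have M0 : 0 < M by rewrite ltr_wpDl//; case: (a) => ? ?; exact: sqrtr_ge0.
have d0 : 0 < e / M by rewrite divr_gt0.
have [y yx yz] := xz _ d0; have [y' yx' yz'] := xz' _ d0.
have est (E : cstarAlgType R) (p p' q q' : E) : cnorm (p - q) < e / M ->
    cnorm (p' - q') < e / M -> cnorm (a *: p + p' - (a *: q + q')) < e.
  move=> pq pq'; rewrite opprD addrACA -scalerBr.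
  apply: le_lt_trans (cnormD _ _) _; rewrite cnormZ.
  rewrite (_ : e = Normc.normc a * (e / M) + e / M); last first.
    by rewrite -[X in _ + X]mul1r -mulrDl mulrC divfK// gt_eqF.
  by rewrite ler_ltD// ler_wpM2l ?(ltW pq)//; case: (a) => ? ?; exact: sqrtr_ge0.
by exists (polyZ a y ++ y'); rewrite peval_cat pevalZ; exact: est.
Qed.

Lemma ext_graphM x z x' z' : ext_graph x z -> ext_graph x' z' ->
  ext_graph (x ** x') (z ** z').
Proof.
move=> xz xz' e e0.
pose M := cnorm x + cnorm x' + cnorm z + cnorm z' + 2.
have M0 : 0 < M by rewrite /M ltr_wpDl// !addr_ge0 ?cnorm_ge0.
pose d := Num.min 1 (e / M).
have d0 : 0 < d by rewrite lt_min ltr01 divr_gt0.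
have d1 : d <= 1 by rewrite ge_min lexx.
have dM : d * M <= e by rewrite -ler_pdivlMr// ge_min lexx orbT.
have [y yx yz] := xz _ d0; have [y' yx' yz'] := xz' _ d0.
have := cnorm_ge0 x; have := cnorm_ge0 x'.
have := cnorm_ge0 z; have := cnorm_ge0 z' => *.
exists (polyM y y'); rewrite pevalM; apply: (cnormM_lt (M := M)) d1 dM _ _ => //;
  rewrite /M; lra.
Qed.

Lemma ext_graphV x z : ext_graph x z -> ext_graph (cstar x) (cstar z).
Proof.
move=> xz e e0; have [y yx yz] := xz _ e0.
by exists (polyV y); rewrite pevalV -cstarN -cstarD cnorm_star.
Qed.

Lemma ext_graph_norm x z : ext_graph x z -> cnorm z <= cnorm x.
Proof.
move=> xz; apply/ler_addgt0Pr => e e0.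
have e2 : 0 < e / 2 by rewrite divr_gt0.
have [y yx yz] := xz _ e2; have := cnorm_peval_le tP sP s0 y.
have := cnormD (peval s y - x) x; have := cnormD (z - peval t y) (peval t y).
rewrite !subrK cnormB; lra.
Qed.

Lemma ext_graph_fun x z z' : ext_graph x z -> ext_graph x z' -> z = z'.
Proof.
move=> xz xz'; apply/eqP; rewrite -subr_eq0; apply/eqP/cnorm_eq0/eqP.
rewrite eq_le cnorm_ge0 andbT.
have := ext_graph_norm (ext_graph_lin (- 1) xz' xz).
by rewrite !scaleN1r addNr cnorm0 addrC.
Qed.

(** The images y(t) of the polynomials y with y(s) close to [x] form a Cauchy
    filter, again by the norm inequality. *)
Lemma ext_graph_ex x :
  (forall e : R, 0 < e -> exists y, cnorm (peval s y - x) < e) ->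
  exists z, ext_graph x z.
Proof.
move=> xy.
pose img (e : R) : set B := [set peval t y | y in [set y | cnorm (peval s y - x) < e]].
pose F := filter_from [set e : R | 0 < e] img.
have FF : ProperFilter F.
  apply: filter_from_proper => [|e /xy[y yx]]; last by exists (peval t y), y.
  apply: filter_from_filter => [|d e d0 e0]; first by exists 1 => /=.
  exists (Num.min d e); first by rewrite /= lt_min d0.
  by move=> _ [y /= + <-]; rewrite lt_min => /andP[yd ye]; split; exists y.
have : cauchy F.
  apply: cauchy_exP => e e0.
  have [r r0 er] : exists2 r : R, 0 < r & e = r%:C.
    exists (complex.Re e); first by move: e0; rewrite ltcE => /andP[].
    by rewrite RRe_real// gtr0_real.
  have r2 : 0 < r / 2 by rewrite divr_gt0.
  have [y yx] := xy _ r2; exists (peval t y), (r / 2) => //.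
  move=> _ [y' /= yx' <-]; rewrite -ball_normE /ball_ /= er cnormE ltcR.
  have := cnorm_peval_le tP sP s0 (y ++ polyZ (- 1) y').
  rewrite !peval_cat !pevalZ !scaleN1r => /le_lt_trans; apply.
  have := cnormD (peval s y - x) (x - peval s y').
  rewrite addrA subrK [cnorm (x - _)]cnormB; lra.
move=> /cauchy_cvg /cvg_ex[z Fz]; exists z => e e0.
have [|d d0 dz] := Fz [set w | cnorm (w - z) < e].
  by apply/nbhs_cnorm; exists e.
have [|y] := xy (Num.min d e); first by rewrite lt_min d0.
by rewrite lt_min => /andP[yd ye]; exists y => //; apply: dz; exists y.
Qed.

Hypothesis s_gen : cstar_gen (range s) = setT.

Lemma ext_graph_total x : exists z, ext_graph x z.
Proof.
pose D : set C := [set x | exists z, ext_graph x z].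
have : cstar_gen (range s) x by rewrite s_gen.
apply: (_ : _ -> D x); apply; split; last first.
  by move=> _ [i _ <-]; exists (t i); exact: ext_graph_gen.
split.
- exists 0; rewrite -[0]subr0 -[X in ext_graph _ X]subr0 => e e0.
  by exists [::]; rewrite /peval big_nil !subr0 cnorm0.
- move=> a y y' [z yz] [z' yz']; exists (a *: z + z'); exact: ext_graph_lin.
- move=> y y' [z yz] [z' yz']; exists (z ** z'); exact: ext_graphM.
- move=> y [z yz]; exists (cstar z); exact: ext_graphV.
- move=> y /closure_cnorm Dy; apply: ext_graph_ex => e e0.
  have e2 : 0 < e / 2 by rewrite divr_gt0.
  have [y' [z /(_ _ e2)[p py' _]] y'y] := Dy _ e2; exists p.
  have := cnormD (peval s p - y') (y' - y); rewrite addrA subrK; lra.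
Qed.

End Extension.

(** A generating family with nonzero q_i is universal.  The isometry clause uses
    the norm inequality in both directions. *)
Theorem star_hom_exists {R : realType} {B C : cstarAlgType R}
    (t : int -> B) (s : int -> C) :
  exel_laca_family wm_matrix t -> exel_laca_family wm_matrix s ->
  (forall i, el_q s i != 0) -> cstar_gen (range s) = setT ->
  exists phi : C -> B,
    [/\ star_hom phi, forall i, phi (s i) = t i &
        (forall i, el_q t i != 0) -> forall x, cnorm (phi x) = cnorm x].
Proof.
move=> tP sP s0 s_gen.
have [phi phiP] := choice (ext_graph_total tP sP s0 s_gen).
have fun_graph := ext_graph_fun tP sP s0.
exists phi; split.
- split=> [a x y|x y|x]; apply: fun_graph (phiP _) _.
  + exact: ext_graph_lin.
  + exact: ext_graphM.
  + exact: ext_graphV.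
- by move=> i; apply: fun_graph (phiP _) (ext_graph_gen t s i).
- move=> t0 x; apply/eqP; rewrite eq_le (ext_graph_norm tP sP s0 (phiP x)) /=.
  apply: (ext_graph_norm sP tP t0) => e e0.
  by have [y ? ?] := phiP x _ e0; exists y.
Qed.

(** * The Hilbert space ell^2 *)
Section Ell2Theory.
Context {R : realType} {I : choiceType}.
Local Notation ell2 := (ell2 R I).
Local Notation normc := Normc.normc.
Implicit Types (f g h : ell2) (u v : I -> R[i]) (a l m : R[i]).

Lemma normc_ge0 (a : R[i]) : 0 <= normc a.
Proof. by case: a => x y; exact: sqrtr_ge0. Qed.

Lemma normc_conj (a : R[i]) : normc (conjc a) = normc a.
Proof. by case: a => x y /=; rewrite sqrrN. Qed.

Lemma normc_real (x : R) : normc x%:C = `|x|.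
Proof. by rewrite /= expr0n/= addr0 sqrtr_sqr. Qed.

Lemma mulc_conj (a : R[i]) : a * conjc a = (normc a ^+ 2)%:C.
Proof. by rewrite -sqr_normc rmorphXn. Qed.

Lemma sqr_mass_fin f : (sqr_mass f < +oo)%E.
Proof. by apply/sqr_massP; case: f. Qed.

Lemma sqr_mass_ge0 u : (0 <= sqr_mass u)%E.
Proof. by apply: esum_ge0 => i _; rewrite lee_fin sqr_ge0. Qed.

Lemma l2norm_ge0 f : 0 <= l2norm f.
Proof. exact: sqrtr_ge0. Qed.

Lemma sqr_massE f : sqr_mass f = (l2norm f ^+ 2)%:E.
Proof.
rewrite /l2norm sqr_sqrtr ?fineK ?fine_ge0 ?sqr_mass_ge0//.
by rewrite ge0_fin_numE ?sqr_mass_ge0// sqr_mass_fin.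
Qed.

Lemma sum_le_l2norm f (s : seq I) : uniq s ->
  \sum_(i <- s) normc (f i) ^+ 2 <= l2norm f ^+ 2.
Proof.
move=> us; rewrite -lee_fin -sqr_massE -sumEFin fsbig_seq//.
by apply: ereal_sup_ubound; exists [set` s] => //; split => //; exact: finite_seq.
Qed.

Lemma sqr_mass_le u (M : R) :
  (forall s : seq I, uniq s -> \sum_(i <- s) normc (u i) ^+ 2 <= M) ->
  (sqr_mass u <= M%:E)%E.
Proof.
move=> uM; apply: ge_ereal_sup => _ [A [fA _] <-].
by rewrite fsbig_finite//= sumEFin lee_fin uM.
Qed.

Lemma ell2_pred_le u (M : R) :
  (forall s : seq I, uniq s -> \sum_(i <- s) normc (u i) ^+ 2 <= M) ->
  u \in ell2_pred.
Proof. by move=> /sqr_mass_le uM; apply/sqr_massP/(le_lt_trans uM)/ltry. Qed.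

Lemma l2norm_le f (M : R) : 0 <= M ->
  (forall s : seq I, uniq s -> \sum_(i <- s) normc (f i) ^+ 2 <= M ^+ 2) ->
  l2norm f <= M.
Proof.
move=> M0 /sqr_mass_le; rewrite sqr_massE lee_fin.
by rewrite ler_pXn2r ?nnegrE ?l2norm_ge0.
Qed.

Lemma normc_le_l2norm f i : normc (f i) <= l2norm f.
Proof.
have /(sum_le_l2norm f) : uniq [:: i] by [].
by rewrite big_seq1 ler_pXn2r ?nnegrE ?l2norm_ge0 ?normc_ge0.
Qed.

Lemma ell2P f g : (forall i, f i = g i) -> f = g.
Proof. by move=> fg; apply/val_inj/funext. Qed.

Lemma ell2_linE a f g i : (a *: f + g : ell2) i = a * f i + g i.
Proof. by []. Qed.

Lemma ell2_subE f g i : (f - g : ell2) i = f i - g i.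
Proof. by []. Qed.

Lemma l2norm_eq0 f : l2norm f = 0 -> f = 0.
Proof.
move=> f0; apply: ell2P => i; apply: Normc.eq0_normc; apply/eqP.
by rewrite eq_le normc_ge0 andbT -f0 normc_le_l2norm.
Qed.

Lemma has_sum_unique u l m : has_sum u l -> has_sum u m -> l = m.
Proof.
move=> ul um; apply/eqP; rewrite -subr_eq0; apply/eqP/Normc.eq0_normc/eqP.
rewrite eq_le normc_ge0 andbT; apply/ler_addgt0Pr => e e0; rewrite add0r.
have e2 : 0 < e / 2 by rewrite divr_gt0.
have [F FP] := ul _ e2; have [G GP] := um _ e2.
have := FP _ (fsubsetUl F G); have := GP _ (fsubsetUr F G).
move: (\sum_(i <- _) _) => S Sm Sl.
rewrite (_ : l - m = (S - m) - (S - l)); last by ring.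
by have := le_normcD (S - m) (- (S - l)); rewrite normcN; lra.
Qed.

Lemma has_sum_lin a u v l m : has_sum u l -> has_sum v m ->
  has_sum (fun i => a * u i + v i) (a * l + m).
Proof.
move=> ul vm e e0; pose M := normc a + 1.
have M0 : 0 < M by rewrite ltr_wpDl// normc_ge0.
have d0 : 0 < e / M by rewrite divr_gt0.
have [F FP] := ul _ d0; have [G GP] := vm _ d0.
exists (F `|` G)%fset => H; rewrite fsubUset => /andP[/FP Hl /GP Hm].
rewrite big_split/= -mulr_sumr.
rewrite (_ : _ - _ = a * (\sum_(i <- H) u i - l) + (\sum_(i <- H) v i - m)); last by ring.
apply: le_lt_trans (le_normcD _ _) _; rewrite Normc.normcM.
rewrite (_ : e = normc a * (e / M) + e / M); last first.
  by rewrite -[X in _ + X]mul1r -mulrDl mulrC divfK// gt_eqF.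
by rewrite ler_ltD// ler_wpM2l ?normc_ge0// ltW.
Qed.

Lemma has_sum_conj u l : has_sum u l -> has_sum (fun i => conjc (u i)) (conjc l).
Proof.
move=> ul e e0; have [F FP] := ul _ e0; exists F => G /FP.
by rewrite -normc_conj rmorphB/= rmorph_sum.
Qed.

Lemma has_sum_single u i : (forall j, j != i -> u j = 0) -> has_sum u (u i).
Proof.
move=> ui e e0; exists [fset i]%fset => G; rewrite fsub1set => iG.
rewrite (big_fsetD1 i)//= big_seq big1 ?addr0 ?subrr ?Normc.normc0//.
by move=> j; rewrite in_fsetD1 => /andP[/ui].
Qed.

(** The partial sums increase to their supremum. *)
Lemma has_sum_mass f : has_sum (fun i => f i * conjc (f i)) (l2norm f ^+ 2)%:C.
Proof.
move=> e e0.
have : (sqr_mass f \is a fin_num)%E by rewrite sqr_massE.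
move=> /(ub_ereal_sup_adherent e0)[_ [A [fA _] <-]].
rewrite -[X in (X - _)%E]/(sqr_mass f) sqr_massE fsbig_finite//= sumEFin -EFinB lte_fin => Ae.
exists (fset_set A) => G AG.
under eq_bigr do rewrite mulc_conj.
rewrite -rmorph_sum -rmorphB normc_real distrC ger0_norm; last first.
  by rewrite subr_ge0 sum_le_l2norm// fset_uniq.
rewrite ltrBlDr -ltrBlDl; apply: lt_le_trans Ae _.
have pA : perm_eq [seq i <- G | i \in fset_set A] (fset_set A).
  apply: uniq_perm; rewrite ?filter_uniq ?fset_uniq// => i.
  by rewrite mem_filter; apply: andb_idr => /(fsubsetP AG).
rewrite [leRHS](bigID (fun i => i \in fset_set A))/= -[X in _ <= X + _]big_filter (perm_big _ pA).
by rewrite lerDl sumr_ge0// => i _; exact: sqr_ge0.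
Qed.

(** The family f_i (g_i)^* is summable by polarization:
    4 f g^* = |f+g|^2 - |f-g|^2 + i |f+ig|^2 - i |f-ig|^2. *)
Lemma l2dotP f g : has_sum (fun i => f i * conjc (g i)) (l2dot f g).
Proof.
suff [l fgl] : exists l, has_sum (fun i => f i * conjc (g i)) l.
  by apply: (@xgetPex _ 0 [set l | has_sum _ l]); exists l.

pose n (a : R[i]) := (l2norm (a *: g + f) ^+ 2)%:C.
have H0 : has_sum (fun _ : I => 0 : R[i]) 0.
  by move=> e e0; exists fset0 => G _; rewrite big1// subrr Normc.normc0.
pose c : R[i] := 4^-1.
exists (c * n 1 + (- c * n (-1) + (c * 'i * n 'i + (- (c * 'i) * n (- 'i) + 0)))).
have := has_sum_lin c (has_sum_mass (1 *: g + f)) (has_sum_lin (- c)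
  (has_sum_mass (-1 *: g + f)) (has_sum_lin (c * 'i) (has_sum_mass ('i *: g + f))
  (has_sum_lin (- (c * 'i)) (has_sum_mass (- 'i *: g + f)) H0))).
congr (has_sum _ _); apply/funext => i; rewrite !ell2_linE.
have conjD (x y : R[i]) : conjc (x + y) = conjc x + conjc y by exact: rmorphD.
have conjM (x y : R[i]) : conjc (x * y) = conjc x * conjc y by exact: rmorphM.
have conjN (x : R[i]) : conjc (- x) = - conjc x by exact: rmorphN.
have conji : conjc ('i : R[i]) = - 'i by simpc.
rewrite !conjD !conjM !conjN conjc1 conji.
have i2 : 'i * 'i = -1 :> R[i] by rewrite -expr2 sqr_i.
have c4 : 4 * c = 1 by rewrite /c divff// pnatr_eq0.
move: (f i) (conjc (f i)) (g i) (conjc (g i)) => x x' y y'.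
transitivity (4 * c * (x * y')); last by rewrite c4 mul1r.
ring: i2.
Qed.

Lemma l2dotDl a f g h : l2dot (a *: f + g) h = a * l2dot f h + l2dot g h.
Proof.
apply: has_sum_unique (l2dotP _ _) _.
have := has_sum_lin a (l2dotP f h) (l2dotP g h).
by congr has_sum; apply/funext => i; rewrite ell2_linE mulrDl mulrA.
Qed.

Lemma l2dot_conj f g : conjc (l2dot f g) = l2dot g f.
Proof.
apply: has_sum_unique (l2dotP _ _).
have := has_sum_conj (l2dotP f g).
by congr has_sum; apply/funext => i; rewrite rmorphM/= conjcK mulrC.
Qed.

Lemma l2dotDr a f g h : l2dot h (a *: f + g) = conjc a * l2dot h f + l2dot h g.
Proof. by rewrite -l2dot_conj l2dotDl rmorphD rmorphM/= !l2dot_conj. Qed.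

Lemma l2dot_self f : l2dot f f = (l2norm f ^+ 2)%:C.
Proof. exact: has_sum_unique (l2dotP _ _) (has_sum_mass f). Qed.

Lemma l2dot0l f : l2dot 0 f = 0.
Proof. by have := l2dotDl (-1) 0 0 f; rewrite scaler0 addr0 mulN1r addNr. Qed.

Lemma l2dot0r f : l2dot f 0 = 0.
Proof. by rewrite -l2dot_conj l2dot0l conjc0. Qed.

Lemma l2dot_basis f i : l2dot f (ell2_basis i) = f i.
Proof.
apply: has_sum_unique (l2dotP _ _) _.
have := @has_sum_single (fun j => f j * conjc (ell2_basis i j)) i.
rewrite /= eqxx conjc_nat mulr1; apply => j /negPf ->.
by rewrite conjc_nat mulr0.
Qed.

Lemma l2norm_lin a f g : l2norm (a *: f + g) ^+ 2 =
  normc a ^+ 2 * l2norm f ^+ 2 + l2norm g ^+ 2 + 2 * complex.Re (a * l2dot f g).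
Proof.
apply: complexI; rewrite -l2dot_self l2dotDl !l2dotDr !l2dot_self.
rewrite -[l2dot g f]l2dot_conj; have := addcJ (a * l2dot f g); have := mulc_conj a.
rewrite [conjc (a * _)]rmorphM.
move: (normc a ^+ 2) (l2norm f ^+ 2) (l2norm g ^+ 2) => na nf ng Ea E.
rewrite !rmorphD !rmorphM/= -Ea (_ : 2%:C = 2%:R) -?E; last by rewrite rmorph_nat.
by ring.
Qed.

Lemma l2norm0 : l2norm (0 : ell2) = 0.
Proof.
by apply/eqP; rewrite -sqrf_eq0; apply/eqP/complexI; rewrite -l2dot_self l2dot0l.
Qed.

Lemma l2normZ a f : l2norm (a *: f) = normc a * l2norm f.
Proof.
apply/eqP; rewrite -(@eqrXn2 _ 2) ?mulr_ge0 ?normc_ge0 ?l2norm_ge0//.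
rewrite -[a *: f]addr0 l2norm_lin l2norm0 l2dot0r mulr0 expr0n !addr0.
by rewrite mulr0 addr0 exprMn.
Qed.

(** Nonnegativity of the squared norm of |g|^2 f - <f, g> g. *)
Lemma cauchy_schwarz f g : normc (l2dot f g) <= l2norm f * l2norm g.
Proof.
have [/l2norm_eq0 ->|g0] := eqVneq (l2norm g) 0.
  by rewrite l2dot0r Normc.normc0 mulr_ge0 ?l2norm_ge0.
have gp : 0 < l2norm g ^+ 2 by rewrite exprn_gt0// lt_neqAle eq_sym g0 l2norm_ge0.
set b := l2dot f g.
have := sqr_ge0 (l2norm (- b *: g + ((l2norm g ^+ 2)%:C *: f + 0))).
rewrite l2norm_lin addr0 l2normZ normcN normc_real ger0_norm ?(ltW gp)//.
rewrite -[_ *: f]addr0 l2dotDr l2dot0r addr0 conjc_real -[l2dot g f]l2dot_conj -/b.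
rewrite (_ : - b * _ = (- (l2norm g ^+ 2 * normc b ^+ 2))%:C) /= => [H|]; last first.
  by rewrite rmorphN/= [in RHS]rmorphM/= -mulc_conj mulNr mulrCA.
have {H} : normc b ^+ 2 <= (l2norm f * l2norm g) ^+ 2.
  rewrite -(ler_pM2l gp) exprMn; nra.
by rewrite ler_pXn2r ?nnegrE ?mulr_ge0 ?normc_ge0 ?l2norm_ge0.
Qed.

Lemma l2normD f g : l2norm (f + g) <= l2norm f + l2norm g.
Proof.
rewrite -(@ler_pXn2r _ 2) ?nnegrE ?addr_ge0 ?l2norm_ge0//.
rewrite -[f]scale1r l2norm_lin scale1r Normc.normc1 expr1n !mul1r sqrrD.
have : complex.Re (l2dot f g) <= normc (l2dot f g).
  by rewrite -lecR (le_trans _ (normc_ge_Re _))// lecR ler_norm.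
have := cauchy_schwarz f g; lra.
Qed.

Lemma l2normN f : l2norm (- f) = l2norm f.
Proof. by rewrite -scaleN1r l2normZ normcN Normc.normc1 mul1r. Qed.

Lemma l2normB f g : l2norm (f - g) = l2norm (g - f).
Proof. by rewrite -l2normN opprB. Qed.

End Ell2Theory.

(** * Bounded operators and adjoints *)
Section BoundedOperators.
Context {R : realType} {I : choiceType}.
Local Notation ell2 := (ell2 R I).
Local Notation normc := Normc.normc.
Implicit Types (f g h : ell2) (T S : ell2 -> ell2) (u : I -> R[i]).

Lemma l2dot_suml (s : seq I) (F : I -> ell2) g :
  l2dot (\sum_(i <- s) F i) g = \sum_(i <- s) l2dot (F i) g.
Proof.
elim: s => [|i s IH]; first by rewrite !big_nil l2dot0l.
by rewrite !big_cons -IH -[F i]scale1r l2dotDl mul1r scale1r.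
Qed.

Lemma l2dotZl a f g : l2dot (a *: f) g = a * l2dot f g.
Proof. by rewrite -[a *: f]addr0 l2dotDl l2dot0l addr0. Qed.

Lemma l2dotBl f g h : l2dot (f - g) h = l2dot f h - l2dot g h.
Proof. by rewrite addrC -scaleN1r l2dotDl mulN1r addrC. Qed.

Lemma ell2_sumE (s : seq I) (F : I -> ell2) j :
  (\sum_(i <- s) F i : ell2) j = \sum_(i <- s) F i j.
Proof.
by elim: s => [|i s IH]; rewrite ?big_nil ?big_cons// -[F i]scale1r ell2_linE IH mul1r scale1r.
Qed.

(** The part of the family [u] supported on [s]: the coordinates need not be
    square summable, which is what allows bounding them one finite set at a time. *)
Definition truncation (s : seq I) u : ell2 := \sum_(i <- s) u i *: ell2_basis i.

Lemma truncationE s u j : uniq s ->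
  truncation s u j = if j \in s then u j else 0.
Proof.
move=> us; rewrite ell2_sumE.
have E i : (u i *: ell2_basis i : ell2) j = if i == j then u j else 0.
  rewrite -[u i *: _]addr0 ell2_linE addr0 /= eq_sym.
  by case: eqVneq => [->|_]; rewrite ?mulr1 ?mulr0.
under eq_bigr do rewrite E.
case: ifP => js; last first.
  by rewrite big_seq big1// => i is_; case: eqP => // ij; rewrite ij js in is_.
by rewrite (bigD1_seq j)//= eqxx big1 ?addr0// => i /negPf ->.
Qed.

Lemma l2dot_truncation s u g : l2dot (truncation s u) g = \sum_(i <- s) u i * conjc (g i).
Proof.
rewrite l2dot_suml; apply: eq_bigr => i _.
by rewrite l2dotZl -l2dot_conj l2dot_basis.
Qed.

Lemma l2norm_truncation s u : uniq s ->
  l2norm (truncation s u) ^+ 2 = \sum_(i <- s) normc (u i) ^+ 2.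
Proof.
move=> us; apply: complexI; rewrite -l2dot_self l2dot_truncation rmorph_sum.
by apply: eq_big_seq => i is_; rewrite truncationE// is_ mulc_conj.
Qed.

Lemma l2norm_sub_truncation s f : uniq s ->
  l2norm (truncation s f - f) ^+ 2 = l2norm f ^+ 2 - \sum_(i <- s) normc (f i) ^+ 2.
Proof.
move=> us; rewrite l2normB addrC -scaleN1r l2norm_lin l2norm_truncation//.
rewrite normcN Normc.normc1 expr1n mul1r mulN1r l2dot_truncation.
under [X in complex.Re (- X)]eq_bigr do rewrite mulc_conj.
by rewrite -rmorph_sum -rmorphN /=; ring.
Qed.

Lemma op0 T : bounded_op T -> T 0 = 0.
Proof. by move=> [Tl _]; have := Tl (-1) 0 0; rewrite scaler0 addr0 scaleN1r addNr. Qed.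

Lemma op_sum T (s : seq I) u (F : I -> ell2) : bounded_op T ->
  T (\sum_(i <- s) u i *: F i) = \sum_(i <- s) u i *: T (F i).
Proof.
move=> Tb; elim: s => [|i s IH]; first by rewrite !big_nil op0.
by rewrite !big_cons -IH; case: Tb => ->.
Qed.

Lemma opB T f g : bounded_op T -> T (f - g) = T f - T g.
Proof. by move=> [Tl _]; rewrite addrC -scaleN1r Tl scaleN1r addrC. Qed.

Definition op_bounds T : set R :=
  [set M | 0 <= M /\ forall f, l2norm (T f) <= M * l2norm f].

Definition opnorm T : R := inf (op_bounds T).

Lemma op_bounds_neq0 T : bounded_op T -> op_bounds T !=set0.
Proof.
move=> [_ [M TM]]; exists `|M|; split=> // f.
by rewrite (le_trans (TM f))// ler_wpM2r ?l2norm_ge0 ?ler_norm.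
Qed.

Lemma opnorm_ge0 T : bounded_op T -> 0 <= opnorm T.
Proof. by move=> Tb; apply: lb_le_inf => [|M []//]; exact: op_bounds_neq0. Qed.

Lemma opnormP T f : bounded_op T -> l2norm (T f) <= opnorm T * l2norm f.
Proof.
move=> Tb; have [/l2norm_eq0 ->|f0] := eqVneq (l2norm f) 0.
  by rewrite op0// l2norm0 mulr0.
have fp : 0 < l2norm f by rewrite lt_neqAle eq_sym f0 l2norm_ge0.
rewrite -ler_pdivrMr//; apply: lb_le_inf; first exact: op_bounds_neq0.
by move=> M [_ TM]; rewrite ler_pdivrMr.
Qed.

Lemma opnorm_le T (M : R) : 0 <= M ->
  (forall f, l2norm (T f) <= M * l2norm f) -> opnorm T <= M.
Proof. by move=> M0 TM; apply: ge_inf => //; exists 0 => N []. Qed.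

(** The coordinates <g, T e_i> that T^* g has to have. *)
Definition riesz T g : I -> R[i] := fun i => l2dot g (T (ell2_basis i)).

(** If h is the truncation of the coordinates to s, then |h|^2 = <T h, g>, so
    |h|^2 <= |T| |h| |g|. *)
Lemma riesz_sum T g (s : seq I) : bounded_op T -> uniq s ->
  \sum_(i <- s) normc (riesz T g i) ^+ 2 <= (opnorm T * l2norm g) ^+ 2.
Proof.
move=> Tb us; rewrite -l2norm_truncation//.
set h := truncation s _; have hE : l2norm h ^+ 2 <= l2norm (T h) * l2norm g.
  apply: le_trans (cauchy_schwarz _ _).
  rewrite op_sum// l2dot_suml l2norm_truncation//.
  under [X in normc X]eq_bigr do rewrite l2dotZl -[l2dot _ g]l2dot_conj mulc_conj.
  by rewrite -rmorph_sum normc_real ler_norm.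
have := opnormP h Tb => Th; have := l2norm_ge0 h; have := l2norm_ge0 g.
have := opnorm_ge0 Tb; move: hE Th; move: (opnorm T) => M hE Th M0 g0 h0.
rewrite ler_pXn2r ?nnegrE ?mulr_ge0//.
have [->|hn0] := eqVneq (l2norm h) 0; first by rewrite mulr_ge0.
have hp : 0 < l2norm h by rewrite lt_neqAle eq_sym hn0.
rewrite -(ler_pM2r hp) -expr2 (le_trans hE)// mulrAC ler_wpM2r//.
Qed.

Lemma riesz_ell2 T g : bounded_op T -> riesz T g \in ell2_pred.
Proof. by move=> Tb; apply: ell2_pred_le => s; exact: riesz_sum. Qed.

Lemma riesz_dot T f g (gT : riesz T g \in ell2_pred) : bounded_op T ->
  l2dot (T f) g = l2dot f (Ell2 gT).
Proof.
move=> Tb; apply/esym/(has_sum_unique (l2dotP _ _)) => /= e e0.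
pose K := opnorm T * l2norm g + 1.
have K0 : 0 < K by rewrite ltr_wpDl// mulr_ge0 ?opnorm_ge0 ?l2norm_ge0.
have d0 : 0 < (e / K) ^+ 2 by rewrite exprn_gt0// divr_gt0.
have [F FP] := has_sum_mass f d0; exists F => G /FP.
under eq_bigr do rewrite mulc_conj.
rewrite -rmorph_sum -rmorphB normc_real distrC.
rewrite -l2norm_sub_truncation ?fset_uniq// ger0_norm ?sqr_ge0//.
rewrite ltr_pXn2r ?nnegrE ?l2norm_ge0 ?divr_ge0 ?ltW// => fG.
rewrite (_ : _ - _ = l2dot (T (truncation G f - f)) g); last first.
  rewrite opB// l2dotBl op_sum// l2dot_suml.
  by congr (_ - _); apply: eq_bigr => i _; rewrite l2dotZl l2dot_conj.
apply: le_lt_trans (cauchy_schwarz _ _) _.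
apply: (@le_lt_trans _ _ (opnorm T * l2norm (truncation G f - f) * l2norm g)).
  by rewrite ler_wpM2r ?l2norm_ge0// opnormP.
rewrite mulrAC; apply: (@le_lt_trans _ _ (K * l2norm (truncation G f - f))).
  by rewrite ler_wpM2r ?l2norm_ge0// lerDl.
by rewrite mulrC -ltr_pdivlMr.
Qed.

Lemma l2dot_inj f g : (forall h, l2dot h f = l2dot h g) -> f = g.
Proof.
move=> fg; apply: ell2P => i; rewrite -!l2dot_basis.
by rewrite -[LHS]l2dot_conj -[RHS]l2dot_conj fg.
Qed.

Lemma adjointP T : bounded_op T -> forall f g, l2dot (T f) g = l2dot f (adjoint T g).
Proof.
move=> Tb; apply: (@xgetPex _ _ [set S | forall f g, l2dot (T f) g = l2dot f (S g)]).
by exists (fun g => Ell2 (riesz_ell2 g Tb)) => f g; exact: riesz_dot.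
Qed.

Lemma adjointP' T : bounded_op T -> forall f g, l2dot (adjoint T f) g = l2dot f (T g).
Proof. by move=> Tb f g; rewrite -l2dot_conj -adjointP// l2dot_conj. Qed.

Lemma adjoint_unique T S : bounded_op T ->
  (forall f g, l2dot (T f) g = l2dot f (S g)) -> adjoint T = S.
Proof.
by move=> Tb TS; apply/funext => g; apply: l2dot_inj => f; rewrite -adjointP.
Qed.

Lemma adjointE T g i : bounded_op T -> adjoint T g i = l2dot g (T (ell2_basis i)).
Proof. by move=> Tb; rewrite -l2dot_basis adjointP'. Qed.

Lemma l2norm_adjoint T g : bounded_op T -> l2norm (adjoint T g) <= opnorm T * l2norm g.
Proof.
move=> Tb; apply: l2norm_le => [|s us].
  by rewrite mulr_ge0 ?opnorm_ge0 ?l2norm_ge0.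
under eq_bigr do rewrite adjointE//.
exact: riesz_sum.
Qed.

Lemma adjoint_bounded T : bounded_op T -> bounded_op (adjoint T).
Proof.
move=> Tb; split; last by exists (opnorm T) => f; exact: l2norm_adjoint.
move=> a f g; apply: l2dot_inj => h.
by rewrite -adjointP// !l2dotDr -!adjointP.
Qed.

Lemma adjointK T : bounded_op T -> adjoint (adjoint T) = T.
Proof. by move=> Tb; apply: adjoint_unique (adjoint_bounded Tb) (adjointP' Tb). Qed.

Lemma comp_bounded T S : bounded_op T -> bounded_op S -> bounded_op (T \o S).
Proof.
move=> Tb Sb; split=> [a f g /=|]; first by case: Sb => -> _; case: Tb => ->.
exists (opnorm T * opnorm S) => f /=; apply: le_trans (opnormP _ Tb) _.
by rewrite -mulrA ler_wpM2l ?opnorm_ge0// opnormP.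
Qed.

Lemma lin_bounded (a : R[i]) T S : bounded_op T -> bounded_op S ->
  bounded_op (fun f => a *: T f + S f).
Proof.
move=> Tb Sb; split=> [b f g /=|].
  case: (Tb) => -> _; case: (Sb) => -> _.
  by rewrite scalerDr !scalerA mulrC -scalerA addrACA -scalerDr.
exists (normc a * opnorm T + opnorm S) => f; rewrite mulrDl.
rewrite (le_trans (l2normD _ _))// lerD ?opnormP// l2normZ -mulrA.
by rewrite ler_wpM2l ?normc_ge0// opnormP.
Qed.

Lemma zero_bounded : bounded_op (fun=> 0 : ell2).
Proof.
split=> [a f g|]; first by rewrite scaler0 addr0.
by exists 0 => f; rewrite l2norm0 mul0r.
Qed.

Lemma scale_bounded (a : R[i]) T : bounded_op T -> bounded_op (fun f => a *: T f).
Proof.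
move=> Tb; have := lin_bounded a Tb zero_bounded.
by congr bounded_op; apply/funext => f; rewrite addr0.
Qed.

Lemma opnorm0 : opnorm (fun=> 0) = 0.
Proof.
apply/eqP; rewrite eq_le opnorm_le ?opnorm_ge0//=; last first.
  by move=> f; rewrite l2norm0 mul0r.
exact: zero_bounded.
Qed.

Lemma opnorm_eq0 T : bounded_op T -> opnorm T = 0 -> T = fun=> 0.
Proof.
move=> Tb T0; apply/funext => f; apply/l2norm_eq0/eqP.
by rewrite eq_le l2norm_ge0 andbT -(mul0r (l2norm f)) -T0 opnormP.
Qed.

Lemma opnormD T S : bounded_op T -> bounded_op S ->
  opnorm (fun f => T f + S f) <= opnorm T + opnorm S.
Proof.
move=> Tb Sb; apply: opnorm_le => [|f]; first by rewrite addr_ge0 ?opnorm_ge0.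
by rewrite mulrDl (le_trans (l2normD _ _))// lerD ?opnormP.
Qed.

Lemma opnormZ (a : R[i]) T : bounded_op T -> opnorm (fun f => a *: T f) = normc a * opnorm T.
Proof.
have le b S : bounded_op S -> opnorm (fun f => b *: S f) <= normc b * opnorm S.
  move=> Sb; apply: opnorm_le => [|f]; first by rewrite mulr_ge0 ?normc_ge0 ?opnorm_ge0.
  by rewrite l2normZ -mulrA ler_wpM2l ?normc_ge0 ?opnormP.
move=> Tb; have [->|a0] := eqVneq a 0.
  rewrite Normc.normc0 mul0r -[RHS]opnorm0; congr opnorm.
  by apply/funext => f; rewrite scale0r.
apply/eqP; rewrite eq_le le//=.
have na0 : 0 < normc a.
  by rewrite lt_neqAle normc_ge0 eq_sym andbT; apply: contra_neq a0 => /Normc.eq0_normc.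
rewrite -ler_pdivlMl// -Normc.normcV.
have := le a^-1 _ (scale_bounded a Tb).
by under [X in opnorm X]funext do rewrite scalerA mulVf// scale1r.
Qed.

Lemma opnormM T S : bounded_op T -> bounded_op S ->
  opnorm (T \o S) <= opnorm T * opnorm S.
Proof.
move=> Tb Sb; apply: opnorm_le => [|f]; first by rewrite mulr_ge0 ?opnorm_ge0.
by rewrite (le_trans (opnormP _ Tb))// -mulrA ler_wpM2l ?opnorm_ge0// opnormP.
Qed.

Lemma opnorm_adjoint_le T : bounded_op T -> opnorm (adjoint T) <= opnorm T.
Proof.
by move=> Tb; apply: opnorm_le => [|f]; [exact: opnorm_ge0|exact: l2norm_adjoint].
Qed.

(** |T f|^2 = <f, T^* T f> <= |T^* T| |f|^2. *)
Lemma opnorm_cstar T : bounded_op T -> opnorm (adjoint T \o T) = opnorm T ^+ 2.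
Proof.
move=> Tb; have Tb' := adjoint_bounded Tb; have Tc := comp_bounded Tb' Tb.
apply/eqP; rewrite eq_le; apply/andP; split.
  rewrite (le_trans (opnormM Tb' Tb))// expr2 ler_wpM2r ?opnorm_ge0//.
  exact: opnorm_adjoint_le.
have sN := opnorm_ge0 Tc; set N := opnorm (_ \o _) in sN *.
rewrite -[N]sqr_sqrtr// ler_pXn2r ?nnegrE ?opnorm_ge0 ?sqrtr_ge0//.
apply: opnorm_le => [|f]; first exact: sqrtr_ge0.
rewrite -(@ler_pXn2r _ 2) ?nnegrE ?mulr_ge0 ?sqrtr_ge0 ?l2norm_ge0// exprMn [Num.sqrt N ^+ 2]sqr_sqrtr//.
have -> : l2norm (T f) ^+ 2 = normc (l2dot (T f) (T f)).
  by rewrite l2dot_self normc_real ger0_norm ?sqr_ge0.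
rewrite adjointP// (le_trans (cauchy_schwarz _ _))// mulrC expr2 mulrA ler_wpM2r ?l2norm_ge0//.
exact: (opnormP f Tc).
Qed.

End BoundedOperators.

(** * Norm-closed *-subalgebras of B(ell^2) are C*-algebras *)
Section OperatorAlgebra.
Context {R : realType} {I : choiceType}.
Local Notation ell2 := (ell2 R I).
Local Notation normc := Normc.normc.
Context {D : set (ell2 -> ell2)} (DP : op_star_subalg D).

Definition opalg_pred of op_star_subalg D : {pred ell2 -> ell2} :=
  fun T => `[< D T >].

Lemma opalg_predP T : reflect (D T) (T \in opalg_pred DP).
Proof. exact: asboolP. Qed.

Fact opalg_submod : submod_closed (opalg_pred DP).
Proof.
split=> [|a T S /opalg_predP DT /opalg_predP DS]; apply/opalg_predP.
  exact: op_zero DP.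
exact: (op_lin DP).
Qed.

HB.instance Definition _ :=
  GRing.isSubmodClosed.Build R[i] (ell2 -> ell2) (opalg_pred DP) opalg_submod.

(** The type depends on the proof that [D] is a *-subalgebra, from which the
    algebraic structure is inferred. *)
Record opalg := OpAlg { opfun :> ell2 -> ell2 ; _ : opfun \in opalg_pred DP }.

HB.instance Definition _ := [isSub for opfun].
HB.instance Definition _ := [Choice of opalg by <:].
HB.instance Definition _ := [SubChoice_isSubLmodule of opalg by <:].

Implicit Types (x y z : opalg) (f g : ell2).

Lemma opalgP x : D x.
Proof. by case: x => T DT; exact/opalg_predP. Qed.

Lemma opalg_bounded x : bounded_op x.
Proof. exact (op_bounded DP (opalgP x)). Qed.

Definition mk_opalg T (DT : D T) : opalg := OpAlg (introT (opalg_predP T) DT).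

Lemma opalg_inj x y : (forall f, x f = y f) -> x = y.
Proof. by move=> xy; apply/val_inj/funext. Qed.

Lemma opalg_linE a x y f : (a *: x + y) f = a *: x f + y f.
Proof. by []. Qed.

Definition opalg_norm x : R[i] := (opnorm x)%:C.

Fact opalg_normD x y : opalg_norm (x + y) <= opalg_norm x + opalg_norm y.
Proof. by rewrite -rmorphD lecR opnormD//; exact: opalg_bounded. Qed.

Fact opalg_normZ a x : opalg_norm (a *: x) = `|a| * opalg_norm x.
Proof.
rewrite /opalg_norm -[opfun (a *: x)]/(fun f => a *: x f).
by rewrite opnormZ ?rmorphM//; exact: opalg_bounded.
Qed.

Fact opalg_norm_eq0 x : opalg_norm x = 0 -> x = 0.
Proof.
move=> [x0]; apply/val_inj.
exact: opnorm_eq0 (opalg_bounded x) x0.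
Qed.

HB.instance Definition _ := Lmodule_isNormed.Build R[i] opalg
  opalg_normD opalg_normZ opalg_norm_eq0.

Lemma ball_opalgE x (e : R) y : ball x e%:C y <-> opnorm (x - y : opalg) < e.
Proof. by rewrite -ball_normE /ball_ /= -[X in X < _]/(opalg_norm _) ltcR. Qed.

Lemma opalg_subE x y f : (x - y) f = x f - y f.
Proof. by []. Qed.

Section Completeness.
Variables (F : set_system opalg) (FF : ProperFilter F) (Fc : cauchy F).

Lemma opalg_cauchy (e : R) : 0 < e -> exists x : opalg,
  F [set y : opalg | forall f, l2norm (y f - x f) <= e * l2norm f].
Proof.
move=> e0; have e0' : 0 < e%:C by rewrite ltcR.
have [x Fx] := (cauchyP F).1 Fc _ e0'; exists x.
apply: filterS Fx => y /ball_opalgE xy f; rewrite l2normB -opalg_subE.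
rewrite (le_trans (opnormP _ (opalg_bounded _)))// ler_wpM2r ?l2norm_ge0//.
exact: ltW.
Qed.

Lemma opalg_cvg_coord (p : R[i] -> R) f i :
  (forall a b, p (a - b) = p a - p b) -> (forall a, `|p a| <= normc a) ->
  cvg ((fun y : opalg => p (y f i)) @ F).
Proof.
move=> pB p_le; apply: cauchy_cvg; apply: cauchy_exP => e e0.
pose d := e / (l2norm f + 1).
have M0 : 0 < l2norm f + 1 by rewrite ltr_wpDl// l2norm_ge0.
have d0 : 0 < d by rewrite divr_gt0.
have [x Fx] := opalg_cauchy d0; exists (p (x f i)).
apply: (@filterS _ F _ _ _ _ Fx) => y xy.
  rewrite /= -ball_normE /ball_ /= distrC -pB.
apply: le_lt_trans (p_le _) _.
rewrite -ell2_subE.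
apply: le_lt_trans (normc_le_l2norm _ _) _; apply: le_lt_trans (xy f) _.
by rewrite /d mulrAC ltr_pdivrMr// ltr_pM2l// ltrDl.
Qed.

(** The limit is taken coordinatewise: on a Cauchy filter of operators
    every coordinate of T f converges, and bounds on finitely many coordinates
    pass to the limit. *)
Definition limit_coord f : I -> R[i] := fun i =>
  lim ((fun y : opalg => complex.Re (y f i)) @ F) +i*
  lim ((fun y : opalg => complex.Im (y f i)) @ F).

Lemma limit_coord_le f (g : ell2) (M : R) :
  F [set y : opalg | l2norm (y f - g) <= M] -> 0 <= M ->
  forall s : seq I, uniq s ->
    \sum_(i <- s) normc (limit_coord f i - g i) ^+ 2 <= M ^+ 2.
Proof.
move=> Fy M0 s us.
pose n (a b : R) (i : I) := (a - complex.Re (g i)) ^+ 2 + (b - complex.Im (g i)) ^+ 2.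
have normcE (a : R[i]) i : normc (a - g i) ^+ 2 = n (complex.Re a) (complex.Im a) i.
  by rewrite normc_sqr /n; case: a (g i) => a b [].
apply: (@cvgr_to_le _ F _ _
    (fun y : opalg => \sum_(i <- s) normc (y f i - g i) ^+ 2)); last first.
  apply: filterS Fy => y yM; apply: (@le_trans _ _ (l2norm (y f - g) ^+ 2)).
    apply: le_trans (sum_le_l2norm _ us); apply: ler_sum => i _.
    by rewrite ell2_subE.
  by rewrite ler_pXn2r ?nnegrE ?l2norm_ge0.
have re_cvg i : (fun y : opalg => complex.Re (y f i)) @ F --> complex.Re (limit_coord f i).
  suff : cvg ((fun y : opalg => complex.Re (y f i)) @ F) by [].
  apply: opalg_cvg_coord => [[? ?] [? ?]//|[x y]].
  by rewrite /= -sqrtr_sqr ler_wsqrtr// lerDl sqr_ge0.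
have im_cvg i : (fun y : opalg => complex.Im (y f i)) @ F --> complex.Im (limit_coord f i).
  suff : cvg ((fun y : opalg => complex.Im (y f i)) @ F) by [].
  apply: opalg_cvg_coord => [[? ?] [? ?]//|[x y]].
  by rewrite /= -sqrtr_sqr ler_wsqrtr// lerDr sqr_ge0.
elim: s {us} => [|i s IH].
  by under eq_fun do rewrite big_nil; rewrite big_nil; exact: cvg_cst.
under eq_fun do rewrite big_cons.
rewrite big_cons; apply: cvgD IH.
under eq_fun do rewrite normcE.
rewrite normcE /n; apply: cvgD; rewrite expr2; under eq_fun do rewrite expr2.
  by apply: cvgM; apply: cvgB; try exact: cvg_cst; exact: re_cvg.
by apply: cvgM; apply: cvgB; try exact: cvg_cst; exact: im_cvg.
Qed.

Fact limit_ell2 f : limit_coord f \in ell2_pred.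
Proof.
have [x Fx] := opalg_cauchy ltr01.
apply: (@ell2_pred_le _ _ _ ((l2norm (x f) + l2norm f) ^+ 2)) => s us.
have M0 : 0 <= l2norm (x f) + l2norm f by rewrite addr_ge0 ?l2norm_ge0.
have E i : limit_coord f i = limit_coord f i - (0 : ell2) i.
  exact: esym (subr0 (limit_coord f i)).
under eq_bigr do rewrite E.
apply: (limit_coord_le (g := 0)) => //; apply: filterS Fx => y xy.
rewrite /= subr0 -[y f](subrK (x f)).
by rewrite (le_trans (l2normD _ _))// addrC lerD2l -[l2norm f]mul1r.
Qed.

Definition limit_op f : ell2 := Ell2 (limit_ell2 f).

Lemma limit_op_le (e : R) : 0 < e -> exists x : opalg,
  F [set y : opalg | forall f, l2norm (y f - x f) <= e * l2norm f] /\
  forall f, l2norm (limit_op f - x f) <= e * l2norm f.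
Proof.
move=> e0; have [x Fx] := opalg_cauchy e0; exists x; split=> // f.
have M0 : 0 <= e * l2norm f by rewrite mulr_ge0 ?l2norm_ge0 ?ltW.
apply: l2norm_le => // s us; under eq_bigr do rewrite ell2_subE.
apply: limit_coord_le => //.
by apply: filterS Fx => y; apply.
Qed.

(** Linearity is inherited in the limit because the approximation is uniform. *)
Lemma limit_op_bounded : bounded_op limit_op.
Proof.
split=> [a f g|]; last first.
  have [x [_ xl]] := limit_op_le ltr01; exists (1 + opnorm x) => f.
  rewrite mulrDl -[limit_op f](subrK (x f)) (le_trans (l2normD _ _))//.
  by rewrite lerD// opnormP//; exact: opalg_bounded.
apply/eqP; rewrite -subr_eq0; apply/eqP/l2norm_eq0/eqP.
rewrite eq_le l2norm_ge0 andbT.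
pose M := l2norm (a *: f + g) + normc a * l2norm f + l2norm g + 1.
have M0 : 0 < M by rewrite ltr_wpDl// !addr_ge0 ?mulr_ge0 ?normc_ge0 ?l2norm_ge0.
apply/ler_addgt0Pr => e e0; rewrite add0r.
have d0 : 0 < e / M by rewrite divr_gt0.
have [x [_ xl]] := limit_op_le d0.
have xlin : x (a *: f + g) = a *: x f + x g by case: (opalg_bounded x) => ->.
rewrite (_ : _ - _ = (limit_op (a *: f + g) - x (a *: f + g)) +
   ((- a) *: (limit_op f - x f) + (- (limit_op g - x g)))); last first.
  rewrite xlin scalerBr !scaleNr opprK opprB [- (a *: _) + _]addrC.
  by rewrite [_ + (x g - _)]addrACA -opprD addrA subrK.
apply: le_trans (l2normD _ _) _.
have := l2normD (- a *: (limit_op f - x f)) (- (limit_op g - x g)).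
rewrite l2normZ normcN l2normN.
have := ler_wpM2l (normc_ge0 a) (xl f).
have := xl (a *: f + g); have := xl g.
have -> : e = e / M * M by rewrite divfK// gt_eqF.
rewrite mulfK ?gt_eqF// {4}/M !mulrDr [normc a * (_ * _)]mulrCA; lra.
Qed.

Lemma limit_op_in : D limit_op.
Proof.
apply: (op_closed DP) limit_op_bounded _ => e e0.
by have [x [_ xl]] := limit_op_le e0; exists x => //; exact: opalgP.
Qed.

Lemma opalg_complete : cvg F.
Proof.
apply/cvg_ex; exists (mk_opalg limit_op_in) => U /nbhs_ballP[e0 /= e00].
have [e e_gt0 ->] : exists2 e : R, 0 < e & e0 = e%:C.
  exists (complex.Re e0); first by move: e00; rewrite ltcE => /andP[].
  by rewrite RRe_real// gtr0_real.
have e3 : 0 < e / 3 by rewrite divr_gt0.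
move=> FU; have [x [Fx xl]] := limit_op_le e3.
apply: filterS Fx => y xy; apply: FU; apply/ball_opalgE.
apply: (@le_lt_trans _ _ (e / 3 + e / 3)); last by lra.
apply: opnorm_le => [|f]; first by lra.
rewrite opalg_subE /= -[limit_op f](subrK (x f)) -addrA mulrDl.
by rewrite (le_trans (l2normD _ _))// lerD// l2normB.
Qed.

End Completeness.

HB.instance Definition _ := Uniform_isComplete.Build opalg opalg_complete.

Definition opalg_mul x y : opalg := mk_opalg (op_comp DP (opalgP x) (opalgP y)).

Definition opalg_star x : opalg := mk_opalg (op_adjoint DP (opalgP x)).

Lemma opalg_dot x f g : l2dot (x f) g = l2dot f (opalg_star x g).
Proof. by rewrite (adjointP (opalg_bounded x)). Qed.

Lemma opalg_star_unique x y : (forall f g, l2dot (x f) g = l2dot f (y g)) ->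
  opalg_star x = y.
Proof. by move=> xy; apply/val_inj/adjoint_unique => //; exact: opalg_bounded. Qed.

Fact opalg_mulA : associative opalg_mul.
Proof. by move=> x y z; exact: opalg_inj. Qed.

Fact opalg_mulDl : left_distributive opalg_mul +%R.
Proof. by move=> x y z; exact: opalg_inj. Qed.

Fact opalg_mulDr : right_distributive opalg_mul +%R.
Proof.
move=> x y z; apply: opalg_inj => f.
have [xl _] := opalg_bounded x; have := xl 1 (y f) (z f).
by rewrite !scale1r.
Qed.

Fact opalg_mulZl a x y : opalg_mul (a *: x) y = a *: opalg_mul x y.
Proof. exact: opalg_inj. Qed.

Fact opalg_mulZr a x y : opalg_mul x (a *: y) = a *: opalg_mul x y.
Proof.
apply: opalg_inj => f; have [xl _] := opalg_bounded x.
by have := xl a (y f) 0; rewrite (op0 (opalg_bounded x)) !addr0.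
Qed.

Fact opalg_star_lin (a : R[i]) x y :
  opalg_star (a *: x + y) = conjc a *: opalg_star x + opalg_star y.
Proof.
apply: opalg_star_unique => f g.
by rewrite !opalg_linE l2dotDl l2dotDr conjcK !opalg_dot.
Qed.

Fact opalg_starD : {morph opalg_star : x y / x + y}.
Proof.
move=> x y; have := opalg_star_lin 1 x y.
by rewrite conjc1 !scale1r.
Qed.

Fact opalg_starZ a x : opalg_star (a *: x) = conjc a *: opalg_star x.
Proof.
apply: opalg_star_unique => f g.
have := l2dotDl a (x f) 0 g; rewrite addr0 l2dot0l addr0 => ->.
have := l2dotDr (conjc a) (opalg_star x g) 0 f; rewrite addr0 l2dot0r addr0 conjcK.
by rewrite opalg_dot.
Qed.

Fact opalg_starM x y : opalg_star (opalg_mul x y) = opalg_mul (opalg_star y) (opalg_star x).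
Proof. by apply: opalg_star_unique => f g; rewrite /= !opalg_dot. Qed.

Fact opalg_starK : involutive opalg_star.
Proof. by move=> x; apply/val_inj/adjointK/opalg_bounded. Qed.

Fact opalg_norm_mul x y : `|opalg_mul x y| <= `|x| * `|y|.
Proof.
rewrite -[ `|_|]/(opalg_norm _) -[ `|x|]/(opalg_norm _) -[ `|y|]/(opalg_norm _).
rewrite -rmorphM lecR; exact: (opnormM (opalg_bounded x) (opalg_bounded y)).
Qed.

Fact opalg_norm_cstar x : `|opalg_mul (opalg_star x) x| = `|x| ^+ 2.
Proof.
rewrite -[ `|_|]/(opalg_norm _) -[ `|x|]/(opalg_norm _) -rmorphXn; congr _%:C.
exact: (opnorm_cstar (opalg_bounded x)).
Qed.

HB.instance Definition _ := CompleteNormedModule_isCStarAlg.Build R opalg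
  opalg_mulA opalg_mulDl opalg_mulDr opalg_mulZl opalg_mulZr
  opalg_starD opalg_starZ opalg_starM opalg_starK
  opalg_norm_mul opalg_norm_cstar.

End OperatorAlgebra.

(** * Creators and annihilators *)
Section WeaklyMonotoneFock.
Context {R : realType}.
Local Notation fock := (wm_fock R).
Local Notation normc := Normc.normc.
Implicit Types (f g : fock) (i j : int) (v w : wm_word).

Definition below i w : bool := if val w is j :: _ then j <= i else true.

Definition starts i w : bool := if val w is j :: _ then j == i else false.

Lemma insub_cons i w :
  if (insub (i :: val w) : option wm_word) is Some v
  then below i w /\ val v = i :: val w else ~~ below i w.
Proof.
have E : sorted (fun i j : int => j <= i) (i :: val w) = below i w.
  by rewrite /below; case: w => -[|j w] //= ->; rewrite andbT.
by case: insubP => [v|]; rewrite E.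
Qed.

Lemma wm_uncons_starts i v : 
  if wm_uncons i v is Some w then starts i v /\ val v = i :: val w else ~~ starts i v.
Proof.
case E: (wm_uncons i v) => [w|].
  by have /wm_uncons_val vE := E; rewrite /starts vE eqxx.
apply: contraPN E; rewrite /starts; case vE: (val v) => [//|j u] /eqP ji.
have su : sorted (fun i j : int => j <= i) u.
  by have := valP v; rewrite vE => /path_sorted.
suff -> : wm_uncons i v = Some (Sub u su) by [].
by apply/wm_uncons_val; rewrite SubK vE ji.
Qed.

Lemma wm_creatorE i f v :
  wm_creator i f v = if wm_uncons i v is Some w then f w else 0.
Proof. by []. Qed.

Lemma wm_creator_lin i (a : R[i]) f g :
  wm_creator i (a *: f + g) = a *: wm_creator i f + wm_creator i g.
Proof.
apply: ell2P => v; rewrite ell2_linE /=.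
by case: (wm_uncons i v) => [w|]; rewrite ?mulr0 ?addr0.
Qed.

Lemma l2norm_wm_creator i f : l2norm (wm_creator i f) <= l2norm f.
Proof.
apply: l2norm_le; first exact: l2norm_ge0.
move=> s us; apply: le_trans (_ : \sum_(w <- pmap (wm_uncons i) s) normc (f w) ^+ 2 <= _).
  rewrite big_pmap; apply: ler_sum => v _.
  rewrite wm_creatorE.
  by case: (wm_uncons i v) => [w|]; [exact: lexx|rewrite Normc.normc0 expr0n].
pose c w : wm_word := odflt w (insub (i :: val w)).
apply: sum_le_l2norm; apply: (@pmap_uniq _ _ _ c) us => v /=.
case E: (wm_uncons i v) => [w|] //=.
by have /wm_uncons_val vE := E; rewrite /c -vE valK.
Qed.

Lemma wm_creator_bounded i : bounded_op (@wm_creator R i).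
Proof.
split=> [a f g|]; first exact: wm_creator_lin.
by exists 1 => f; rewrite mul1r l2norm_wm_creator.
Qed.

(** The coordinate at [w] of the adjoint is read off by pairing with A_i^dagger
    e_w, a basis vector or 0. *)
Lemma wm_annihilatorE i f w :
  wm_annihilator i f w = if insub (i :: val w) is Some v then f v else 0.
Proof.
rewrite (adjointE _ _ (wm_creator_bounded i)) wm_creator_basis.
by case: insub => [v|]; rewrite ?l2dot_basis ?l2dot0r.
Qed.

Lemma annihilator_creatorE i f w :
  wm_annihilator i (wm_creator i f) w = (below i w)%:R * f w.
Proof.
rewrite wm_annihilatorE; have := insub_cons i w.
case: insub => [v [-> vE]|/negPf ->] /=; last by rewrite mul0r.
by have /wm_uncons_val -> := vE; rewrite mul1r.
Qed.

Lemma creator_annihilatorE i f v :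
  wm_creator i (wm_annihilator i f) v = (starts i v)%:R * f v.
Proof.
rewrite /=; have := wm_uncons_starts i v.
case: wm_uncons => [w [-> vE]|/negPf ->] /=; last by rewrite mul0r.
by rewrite wm_annihilatorE -vE valK mul1r.
Qed.

End WeaklyMonotoneFock.

Lemma bounded_star_subalg (R : realType) (I : choiceType) :
  op_star_subalg [set T : ell2 R I -> ell2 R I | bounded_op T].
Proof.
split=> //=.
- exact: zero_bounded.
- move=> a T S; exact: lin_bounded.
- move=> T S; exact: comp_bounded.
- move=> T; exact: adjoint_bounded.
Qed.

Lemma op_cstar_gen_subalg (R : realType) (I : choiceType)
    (G : set (ell2 R I -> ell2 R I)) :
  (forall T, G T -> bounded_op T) -> op_star_subalg (op_cstar_gen G).
Proof.
move=> Gb; split=> [T GT|D [DP _]|a T S GT GS D DP|T S GT GS D DP|T GT D DP|T Tb TG D DP].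
- by apply: (GT [set T | bounded_op T]); split=> //; exact: bounded_star_subalg.
- exact: (op_zero DP).
- by apply: (op_lin DP.1); [exact: GT|exact: GS].
- by apply: (op_comp DP.1); [exact: GT|exact: GS].
- by apply: (op_adjoint DP.1); exact: GT.
- apply: (op_closed DP.1) => // e /TG[S GS TS]; exists S => //; exact: GS.
Qed.

Lemma wm_algebra_subalg (R : realType) : op_star_subalg (wm_algebra R).
Proof.
apply: op_cstar_gen_subalg => _ [i _ <-].
exact/adjoint_bounded/wm_creator_bounded.
Qed.

Lemma wm_annihilator_in (R : realType) i : wm_algebra R (wm_annihilator i).
Proof. by move=> D [_]; apply; exists i. Qed.

Lemma wm_creator_in (R : realType) i : wm_algebra R (wm_creator i).
Proof.
rewrite -(adjointK (wm_creator_bounded i)).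
exact: (op_adjoint (wm_algebra_subalg R)) (wm_annihilator_in i).
Qed.

(** * The weakly monotone algebra as an Exel-Laca algebra *)
Section FockRelations.
Context {R : realType}.

Local Notation wm_cstar := (opalg (wm_algebra_subalg R)).

Definition wm_gen (i : int) : wm_cstar :=
  mk_opalg (wm_algebra_subalg R) (wm_creator_in i).

Implicit Types (b x y : wm_cstar) (f : wm_fock R) (w : wm_word) (i j : int).

Lemma wm_genE i f : wm_gen i f = wm_creator i f.
Proof. by []. Qed.

Lemma wm_gen_qE i f w : el_q wm_gen i f w = (below i w)%:R * f w.
Proof. exact: annihilator_creatorE. Qed.

Lemma wm_gen_pE i f w : el_p wm_gen i f w = (starts i w)%:R * f w.
Proof. exact: creator_annihilatorE. Qed.

Lemma wm_cstar_eq x y : (forall f w, x f w = y f w) -> x = y.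
Proof. by move=> xy; apply: opalg_inj => f; exact: ell2P. Qed.

Lemma wm_cstar_mulE x y f : (x ** y) f = x (y f).
Proof. by []. Qed.

Lemma wm_cstar_scaleE (a : R[i]) x f w : (a *: x) f w = a * x f w.
Proof. by []. Qed.

Lemma wm_cstar_sumE (J : Type) (r : seq J) (F : J -> wm_cstar) f w :
  (\sum_(j <- r) F j) f w = \sum_(j <- r) F j f w.
Proof.
elim: r => [|j r IH]; first by rewrite !big_nil.
by rewrite !big_cons -IH.
Qed.

Lemma el_prod_wmE (X Y : {fset int}) b f w : el_prod wm_gen X Y b f w =
  (\prod_(i <- X) (below i w)%:R) * (\prod_(i <- Y) (1 - (below i w)%:R)) * b f w.
Proof.
have compE (h k : wm_cstar -> wm_cstar) c : (h \o k) c = h (k c) by [].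
rewrite /el_prod compE.
have qX (r : seq int) b' :
    (\big[(fun h k => h \o k)/id]_(i <- r) (fun b => el_q wm_gen i ** b)) b' f w =
    (\prod_(i <- r) (below i w)%:R) * b' f w.
  elim: r => [|i r IH]; first by rewrite !big_nil mul1r.
  by rewrite !big_cons compE wm_cstar_mulE wm_gen_qE IH mulrA.
have qY (r : seq int) b' :
    (\big[(fun h k => h \o k)/id]_(i <- r) (fun b => b - el_q wm_gen i ** b)) b' f w =
    (\prod_(i <- r) (1 - (below i w)%:R)) * b' f w.
  elim: r => [|i r IH]; first by rewrite !big_nil mul1r.
  rewrite !big_cons compE opalg_subE ell2_subE wm_cstar_mulE wm_gen_qE IH.
  by rewrite -mulrA mulrBl mul1r.
by rewrite qX qY mulrA.
Qed.

Lemma mem_sum_absz (s : seq int) i : i \in s -> (`|i| <= \sum_(j <- s) `|j|)%N.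
Proof. by move=> si; rewrite (big_rem i si) leq_addr. Qed.

(** All integers below the elements of X have coefficient 1. *)
Lemma el_coef_infinite (X : {fset int}) :
  infinite_set [set j | el_coef wm_matrix X fset0 j != 0 :> R[i]].
Proof.
move=> fin; pose A := fset_set [set j | el_coef wm_matrix X fset0 j != 0 :> R[i]].
pose K := (\sum_(x <- X) `|x| + \sum_(a <- A) `|a| + 1)%N.
have : (- K%:Z) \in A.
  rewrite in_fset_set// inE /= /el_coef big_seq_fset0 mulr1.
  rewrite big_seq big1 ?oner_eq0// => x /mem_sum_absz xX.
  suff -> : wm_matrix x (- K%:Z) by [].
  rewrite /wm_matrix; move: xX; rewrite /K.
  move: (\sum_(j <- X) _)%N (\sum_(j <- A) _)%N => m n; lia.
move=> /mem_sum_absz; rewrite /K.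
move: (\sum_(j <- X) _)%N (\sum_(j <- A) _)%N => m n; lia.
Qed.

(** The q_i and p_i are diagonal in the basis of words, so the relations hold
    coordinatewise.  In the relation on products, the coefficient a(X, Y, j) is
    the diagonal entry of the left-hand side at the words with first letter j.
    The vacuum carries no p_j, and its entry on the left is 0 because Y is not
    empty: otherwise a(X, Y, j) would be nonzero for infinitely many j. *)
Lemma wm_gen_family : exel_laca_family wm_matrix wm_gen.
Proof.
split.
- move=> i; apply: wm_cstar_eq => f w.
  rewrite wm_cstar_mulE wm_gen_pE wm_genE wm_creatorE.
  have := wm_uncons_starts i w; case: wm_uncons => [v [-> _]|_].
    by rewrite mul1r.
  by rewrite mulr0.
- move=> i j; apply: wm_cstar_eq => f w.
  by rewrite !wm_cstar_mulE !wm_gen_qE mulrCA.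
- move=> i j ij; apply: wm_cstar_eq => f w.
  rewrite wm_cstar_mulE !wm_gen_pE mulrA -natrM mulnb.
  rewrite (_ : _ && _ = false) ?mul0r// /starts; case: (val w) => [//|k u].
  by case: eqP => // ->; apply/negbTE.
- move=> i j; apply: wm_cstar_eq => f w.
  rewrite wm_cstar_mulE wm_cstar_scaleE wm_gen_qE !wm_gen_pE /wm_matrix /starts /below.
  case: (val w) => [|k u]; first by rewrite !mul0r !mulr0.
  by case: eqP => [->//|_]; rewrite !mul0r !mulr0.
- move=> X Y fin; apply/funext => b; apply: wm_cstar_eq => f w.
  rewrite el_prod_wmE wm_cstar_mulE; move: (b f) => {b}f.
  set A := [set j | _] in fin.
  have memA j : (j \in fset_set A) = (el_coef wm_matrix X Y j != 0 :> R[i]).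
    by rewrite in_fset_set//; apply/idP/idP => [/set_mem|/mem_set].
  rewrite (fsbigTE (fset_set A)); last first.
    by move=> j; rewrite memA negbK => /eqP ->; rewrite scale0r.
  rewrite wm_cstar_sumE.
  rewrite [RHS](eq_bigr (fun j => el_coef wm_matrix X Y j * (starts j w)%:R * f w)); last first.
    by move=> j _; rewrite -mulrA -wm_gen_pE.
  rewrite -mulr_suml; congr (_ * _).
  rewrite /starts /below; case: (val w) => [|k u].
    rewrite [RHS]big1 => [|j _]; last by rewrite mulr0.
    have [Y0|[y yY]] := fset_0Vmem Y.
      by move: fin; rewrite /A Y0 => /el_coef_infinite.
    by rewrite [X in _ * X](big_fsetD1 y)//= subrr mul0r mulr0.
  rewrite -[LHS]/(el_coef wm_matrix X Y k).
  have [kA|] := boolP (k \in fset_set A).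
    rewrite (big_fsetD1 k)//= eqxx mulr1 big_seq big1 ?addr0// => j.
    by rewrite in_fsetD1 eq_sym => /andP[/negPf -> _]; rewrite mulr0.
  rewrite memA negbK => /eqP k0; rewrite k0 big1_seq// => j /=; rewrite memA => jA.
  by case: eqP => [kj|]; rewrite ?mulr0//; move: jA; rewrite -kj k0 eqxx.
Qed.

Lemma wm_gen_q_neq0 i : el_q wm_gen i != 0.
Proof.
apply/eqP => q0; pose vacuum : wm_word := exist _ [::] isT.
have := wm_gen_qE i (ell2_basis vacuum) vacuum.
rewrite q0 (_ : below i vacuum = true)// mul1r.
rewrite -[X in _ = X -> _]/((vacuum == vacuum)%:R) eqxx => /esym/eqP.
by rewrite oner_eq0.
Qed.

(** A closed *-subalgebra of W that contains the creators is a norm-closed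
    *-subalgebra of operators that contains the annihilators. *)
Lemma wm_gen_generates : cstar_gen (range wm_gen) = setT.
Proof.
apply/seteqP; split=> // x _ D [[D0 Dlin DM DV Dcl] Dgen].
suff : wm_algebra R `<=` [set T | exists2 y : wm_cstar, D y & opfun y = T].
  by move=> /(_ _ (opalgP x))[y Dy /val_inj <-].
move=> T; apply; split; last first.
  move=> _ [i _ <-]; exists (cstar (wm_gen i)) => //; apply: DV; apply: Dgen.
  by exists i.
split.
- by move=> _ [y _ <-]; exact: opalg_bounded.
- by exists 0.
- by move=> a _ _ [y Dy <-] [z Dz <-]; exists (a *: y + z) => //; exact: Dlin.
- by move=> _ _ [y Dy <-] [z Dz <-]; exists (y ** z) => //; exact: DM.
- by move=> _ [y Dy <-]; exists (cstar y) => //; exact: DV.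
- move=> S Sb SD.
  have SW : wm_algebra R S.
    apply: (op_closed (wm_algebra_subalg R)) => // e /SD[_ [y _ <-] Sy].
    by exists y => //; exact: opalgP.
  exists (mk_opalg (wm_algebra_subalg R) SW) => //.
  apply: Dcl; apply/closure_cnorm => e e0.
  have e2 : 0 < e / 2 by rewrite divr_gt0.
  have [_ [y Dy <-] Sy] := SD _ e2; exists y => //.
  rewrite cnormB; apply: (@le_lt_trans _ _ (e / 2)); last by lra.
  by apply: opnorm_le => [|f]; [exact: ltW|exact: Sy].
Qed.

End FockRelations.

(** The set on which two isometric *-homomorphisms agree is a closed
    *-subalgebra. *)
Lemma star_hom_eq {R : realType} {B C : cstarAlgType R} (s : int -> C) (phi psi : C -> B) :
  star_hom phi -> star_hom psi ->
  (forall x, cnorm (phi x) = cnorm x) -> (forall x, cnorm (psi x) = cnorm x) ->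
  (forall i, phi (s i) = psi (s i)) -> cstar_gen (range s) = setT ->
  forall x, phi x = psi x.
Proof.
move=> [phiL phiM phiV] [psiL psiM psiV] phi1 psi1 phipsi s_gen x.
have hom0 (h : C -> B) : (forall x, cnorm (h x) = cnorm x) -> h 0 = 0.
  by move=> h1; apply: cnorm_eq0; rewrite h1 cnorm0.
have homB (h : C -> B) : (forall a x y, h (a *: x + y) = a *: h x + h y) ->
    forall x y, h (x - y) = h x - h y.
  by move=> hL y z; rewrite addrC -scaleN1r hL scaleN1r addrC.
have : cstar_gen (range s) x by rewrite s_gen.
apply: (_ : _ -> [set x | phi x = psi x] x); apply; split; last by move=> _ [i _ <-].
split=> /=.
- by rewrite !hom0.
- by move=> a y z yE zE; rewrite phiL psiL yE zE.
- by move=> y z yE zE; rewrite phiM psiM yE zE.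
- by move=> y yE; rewrite phiV psiV yE.
- move=> y /closure_cnorm yE /=; apply/eqP; rewrite -subr_eq0; apply/eqP/cnorm_eq0/eqP.
  rewrite eq_le cnorm_ge0 andbT; apply/ler_addgt0Pr => e e0; rewrite add0r.
  have e2 : 0 < e / 2 by rewrite divr_gt0.
  have [z zE zy] := yE _ e2.
  rewrite (_ : _ - _ = (phi y - phi z) + (psi z - psi y)); last first.
    by rewrite [phi z]zE addrA subrK.
  have := cnormD (phi y - phi z) (psi z - psi y).
  rewrite -(homB _ phiL) -(homB _ psiL) phi1 psi1 [cnorm (y - z)]cnormB; lra.
Qed.

Theorem theorem2p4 (R : realType) :
  (exists (O : cstarAlgType R) (s : int -> O), is_exel_laca wm_matrix s) /\
  (forall (O : cstarAlgType R) (s : int -> O),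
    is_exel_laca wm_matrix s ->
    exists pi : O -> wm_fock R -> wm_fock R,
      [/\ star_rep pi,
          forall i, pi (s i) = wm_creator i,
          injective pi &
          range pi = wm_algebra R]).
Proof.
have wP := @wm_gen_family R; have w0 := @wm_gen_q_neq0 R.
have wgen := @wm_gen_generates R.
split.
  exists (opalg (wm_algebra_subalg R) : cstarAlgType R), (@wm_gen R); split=> // B t tP.
  by have [phi [? ? _]] := star_hom_exists tP wP w0 wgen; exists phi.
move=> O s [sP sgen suniv].
have s0 i : el_q s i != 0.
  have [phi [[phiL phiM phiV] phis]] := suniv _ _ wP.
  apply: contra_neq (w0 i) => q0; rewrite /el_q -phis -phiV -phiM -/(el_q s i) q0.
  by have := phiL (-1) 0 0; rewrite scaler0 addr0 scaleN1r addNr.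
have [phi [phiH phis phi1]] := star_hom_exists wP sP s0 sgen.
have [psi [psiH psis psi1]] := star_hom_exists sP wP w0 wgen.
have {}phi1 := phi1 w0; have {}psi1 := psi1 s0.
have phipsi x : phi (psi x) = x.
  apply: (star_hom_eq (phi := phi \o psi) (psi := id) _ _ _ _ _ wgen) => //=.
  - case: phiH psiH => [phiL phiM phiV] [psiL psiM psiV].
    by split=> [a y z|y z|y] /=; rewrite ?psiL ?phiL ?psiM ?phiM ?psiV ?phiV.
  - by move=> y; rewrite phi1 psi1.
  - by move=> i; rewrite psis phis.
have [phiL phiM phiV] := phiH.
exists (fun x => opfun (phi x)); split.
- split=> [x|a x y|x y|x]; first exact: opalg_bounded.
  + by rewrite phiL.
  + by rewrite phiM.
  + by rewrite phiV.
- by move=> i; rewrite phis.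
- move=> x y /val_inj xy; apply/eqP; rewrite -subr_eq0; apply/eqP/cnorm_eq0.
  by rewrite -phi1 addrC -scaleN1r phiL xy scaleN1r addNr cnorm0.
- apply/seteqP; split=> [_ [x _ <-]|T WT]; first exact: opalgP.
  by exists (psi (mk_opalg (wm_algebra_subalg R) WT)) => //; rewrite phipsi.
Qed.
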